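(* Let $M_0$ and $M_1$ be smooth generic hypersurfaces in $\mathbb R^n$ oriented by smooth unit normal vector fields $\mathbf n_i$, $i=0,1$, and relatively oriented by $\theta$ for the diffeomorphism $\chi:M_0\to M_1$. Let $\tilde\psi_t(x)=(\mathbf n_t(x),c_t(x)\boldsymbol\epsilon)$, $x\in M_0$, $0\le t\le 1$, be the (smooth) Lorentzian geodesic flow between $M_0$ and $M_1$, let $\tilde M_t=\tilde\psi_t(M_0)\subset\mathcal T^n$, and let $M_t$ be the envelope of $\tilde M_t$. Suppose that for each time $t$, $\tilde M_t$ has only generic Legendrian singularities. Then: (1) $M_t$ will have a unique point corresponding to $z=\tilde\psi_t(x)\in\tilde M_t$ provided the matrix $$N_t'(x)=\lambda(t,\theta)N_1(x)+\lambda(1-t,\theta)N_0(x)+\sigma(t,\theta)\,\frac{\partial\theta}{\partial\mathbf u}\,\mathbf n_0$$ is nonsingular. (2) The envelope $M_t$ will be smooth at points corresponding to a smooth point $z=\tilde\psi_t(x)\in\tilde M_t$ for which $N_t'(x)$ is nonsingular, provided $H(\tilde{\mathbf n}_t(x))\cdot\tilde{\mathbf h}_t(x)$ is nonsingular. (3) At points corresponding to singular points $z\in\tilde M_t$, there is a unique point on $M_t$ for each local component of $\tilde M_t$ in a neighborhood of $z$. This point is the unique limit of the envelope points corresponding to smooth points of the component of $\tilde M_t$ approaching $z$.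
   Context: $\boldsymbol\epsilon=(1,1)$; $\mathcal T^n=\{(\mathbf n,c\boldsymbol\epsilon)=(\mathbf n,c,c):\mathbf n\in S^{n-1},c\in\mathbb R\}\subset\Lambda^{n+1}$ (de Sitter space in Minkowski space $\mathbb R^{n+2}$). $\lambda(x,\theta)=\sin(x\theta)/\sin\theta$ for $0<|\theta|<\pi$, $\lambda(x,0)=x$. $M_0,M_1$ are relatively oriented by $\theta$ for $\chi$ if $\theta:M_0\to(-\pi,\pi)$ is smooth with $\mathbf n_0(x)\cdot\mathbf n_1(\chi(x))=\cos\theta(x)$. With $T_xM_0$ given by $\mathbf n_0(x)\cdot\mathbf x=c_0(x)$ and $T_{\chi(x)}M_1$ by $\mathbf n_1(\chi(x))\cdot\mathbf x=c_1(x)$, the Lorentzian geodesic flow is $\tilde\psi_t(x)=(\mathbf n_t(x),c_t(x)\boldsymbol\epsilon)$ with $\mathbf n_t=\lambda(t,\theta(x))\,\mathbf n_1(\chi(x))+\lambda(1-t,\theta(x))\,\mathbf n_0(x)$, $c_t=\lambda(t,\theta(x))c_1(x)+\lambda(1-t,\theta(x))c_0(x)$. Let $u=(u_1,\dots,u_{n-1})$ be local coordinates on $M_0$; subscripts $u_i$ denote partial derivatives. $N_0$ is the $n\times n$ matrix with columns $\mathbf n_0,\mathbf n_{0,u_1},\dots,\mathbf n_{0,u_{n-1}}$; $N_1$ is the analogous matrix for $u\mapsto\mathbf n_1(\chi(x(u)))$; $\frac{\partial\theta}{\partial\mathbf u}\mathbf n_0$ is the $n\times n$ matrix with first column $0$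 and $(j+1)$-st column $\frac{\partial\theta}{\partial u_j}\mathbf n_0$. For $0\le x\le1$, $\sigma(x,\theta)=\frac{\cos((1-x)\theta)}{\sin\theta}-\frac{x}{\sin(x\theta)}$ if $0<|\theta|<\pi$ (with $x/\sin(x\theta)$ read as $1/\theta$ at $x=0$), and $\sigma(x,0)=0$. Set $\tilde{\mathbf n}_t=(\mathbf n_t,-c_t)\in\mathbb R^{n+1}$; the $n$-fold cross product in $\mathbb R^{n+1}$ is characterized by $v\cdot(v_1\times\cdots\times v_n)=\det(v,v_1,\dots,v_n)$; $\tilde{\mathbf h}_t=\tilde{\mathbf n}_t\times\tilde{\mathbf n}_{t,u_1}\times\cdots\times\tilde{\mathbf n}_{t,u_{n-1}}$; $H(\tilde{\mathbf n}_t)\cdot\tilde{\mathbf h}_t$ is the $(n-1)\times(n-1)$ matrix with entries $\tilde{\mathbf n}_{t,u_iu_j}\cdot\tilde{\mathbf h}_t$. Envelope: $M_t\subset\mathbb R^n$ is the envelope of the family of hyperplanes $\mathbf n\cdot\mathbf x=c$ with $(\mathbf n,c\boldsymbol\epsilon)\in\tilde M_t$; a point $\mathbf x\in\mathbb R^n$ of $M_t$ corresponds to $\tilde\psi_t(x(u))$ if $\mathbf n_t(u)\cdot\mathbf x=c_t(u)$ and $\mathbf n_{t,u_i}(u)\cdot\mathbf x=c_{t,u_i}(u)$, $i=1,\dots,n-1$. Generic hypersurface: the Legendrian map $x\mapsto T_xM$ to the dual projective space is a generic Legendrian projection in the sense of Arnol'd. Generic Legendrian singularities are the singularities of images of generic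 Legendrian projections, i.e. those of discriminants of stable unfoldings of multigerms of hypersurface singularities, or transverse sections of such; for $n=3$: cuspidal edge, swallowtail, transverse intersections of two or three smooth surfaces, and transverse intersection of a cuspidal edge with a smooth surface. Near each point $z$, such a set is a finite transverse union of $(n-1)$-dimensional Whitney stratified sets (its local components at $z$), each of which has a unique limiting tangent space at each of its singular points (the limit of tangent spaces along any sequence of its smooth points converging to the singular point).
   Formalization: Part (3) is stated only for local components whose limiting tangent space at z projects injectively to the space of normals; otherwise the envelope points go to infinity and no limit point exists in R^n, so the claim as written fails. *)

(* Defs.v *)
From HB Require Import structures.
From mathcomp Require Import all_boot all_order all_algebra.
From mathcomp Require Import all_classical all_reals all_analysis.
Set Implicit Arguments.
Unset Strict Implicit.
Unset Printing Implicit Defensive.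
Import Order.TTheory GRing.Theory Num.Theory.
Import numFieldNormedType.Exports.
Local Open Scope classical_set_scope.
Local Open Scope ring_scope.

Section Calculus.
Variable R : realType.

Definition dot (n : nat) (v w : 'rV[R]_n) : R := \sum_(i < n) v 0 i * w 0 i.

Definition pderiv (m : nat) (V : normedModType R) (i : 'I_m)
    (f : 'rV[R]_m -> V) : 'rV[R]_m -> V :=
  fun x => 'D_(delta_mx 0 i) f x.

(* C^oo on U; meant for open U. *)
Definition smooth_on (m : nat) (V : normedModType R) (U : set 'rV[R]_m)
    (f : 'rV[R]_m -> V) : Prop :=
  forall (s : seq 'I_m) x, U x -> differentiable (foldr (@pderiv m V) f s) x.

Definition smooth_at (m : nat) (V : normedModType R) (x : 'rV[R]_m)
    (f : 'rV[R]_m -> V) : Prop :=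
  exists2 U, open_nbhs x U & smooth_on U f.

Definition germ_eq (n : nat) (z : 'rV[R]_n) (A B : set 'rV[R]_n) : Prop :=
  \forall w \near z, A w <-> B w.

(* The i-th row is the partial derivative of f in the i-th direction, so that
   v *m jac f x is the derivative of f at x in the direction v. *)
Definition jac (m n : nat) (f : 'rV[R]_m -> 'rV[R]_n) (x : 'rV[R]_m) :
    'M[R]_(m, n) :=
  \matrix_(i, j) pderiv i f x 0 j.

End Calculus.

Section Submanifolds.
Variable R : realType.

(* The last clause says that phi is open onto its image for the topology
   induced by M; with the other clauses, phi is a diffeomorphism from U onto a
   relatively open subset of M, and its inverse is a local coordinate system. *)
Definition local_param (m n : nat) (M : set 'rV[R]_n) (U : set 'rV[R]_m)
    (phi : 'rV[R]_m -> 'rV[R]_n) : Prop :=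
  [/\ open U, smooth_on U phi,
      forall u, U u -> row_free (jac phi u),
      set_inj U phi
    & forall V, open V -> V `<=` U -> exists2 W, open W & phi @` V = M `&` W].

Definition smooth_point (m n : nat) (A : set 'rV[R]_n) (p : 'rV[R]_n) : Prop :=
  exists U (phi : 'rV[R]_m -> 'rV[R]_n), local_param A U phi /\ (phi @` U) p.

Definition submanifold (m n : nat) (M : set 'rV[R]_n) : Prop :=
  forall p, M p -> smooth_point m M p.

Definition hypersurface (m : nat) (M : set 'rV[R]_m.+1) : Prop :=
  submanifold m M.

(* p is a smooth point of A (in dimension m), and the tangent space of A at p
   is the row space of T. *)
Definition is_tangent_space (m n : nat) (A : set 'rV[R]_n) (p : 'rV[R]_n)
    (T : 'M[R]_n) : Prop :=
  exists U (phi : 'rV[R]_m -> 'rV[R]_n) u,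
    [/\ local_param A U phi, U u, phi u = p & (T == jac phi u)%MS].

Definition smooth_map (m n : nat) (M : set 'rV[R]_n) (V : normedModType R)
    (f : 'rV[R]_n -> V) : Prop :=
  forall U (phi : 'rV[R]_m -> 'rV[R]_n),
    local_param M U phi -> smooth_on U (f \o phi).

Definition diffeomorphism (m n : nat) (M0 M1 : set 'rV[R]_n)
    (chi : 'rV[R]_n -> 'rV[R]_n) : Prop :=
  [/\ set_bij M0 M1 chi, smooth_map m M0 chi
    & exists2 chi', smooth_map m M1 chi' & {in M0, cancel chi chi'}].

Definition unit_normal_field (m : nat) (M : set 'rV[R]_m.+1)
    (nu : 'rV[R]_m.+1 -> 'rV[R]_m.+1) : Prop :=
  smooth_map m M nu /\
  forall x, M x -> dot (nu x) (nu x) = 1 /\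
    forall T (w : 'rV_m.+1),
      is_tangent_space m M x T -> (w <= T)%MS -> dot (nu x) w = 0.

(* Convergence of the row spaces V_i to the row space of T in the Grassmannian. *)
Definition cvg_subspace (n : nat) (V : nat -> 'M[R]_n) (T : 'M[R]_n) : Prop :=
  (forall i, \rank (V i) = \rank T) /\
  forall w : 'rV[R]_n, (w <= T)%MS ->
    exists2 ws : nat -> 'rV[R]_n,
      forall i, (ws i <= V i)%MS & ws i @[i --> \oo] --> w.

Definition is_limiting_tangent_space (m n : nat) (A : set 'rV[R]_n)
    (z : 'rV[R]_n) (T : 'M[R]_n) : Prop :=
  closure [set p | smooth_point m A p] z /\
  forall (zs : nat -> 'rV[R]_n) (Vs : nat -> 'M[R]_n),
    (forall i, is_tangent_space m A (zs i) (Vs i)) ->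
    zs i @[i --> \oo] --> z -> cvg_subspace Vs T.

(* Whitney's condition (b) for the pair (Y, X) at the points of X. *)
Definition whitney_b (n dY : nat) (X Y : set 'rV[R]_n) : Prop :=
  forall p (xs ys : nat -> 'rV[R]_n) (Vs : nat -> 'M[R]_n)
         (l : 'rV[R]_n) (T : 'M[R]_n),
    X p -> (forall i, X (xs i)) -> (forall i, xs i != ys i) ->
    (forall i, is_tangent_space dY Y (ys i) (Vs i)) ->
    xs i @[i --> \oo] --> p -> ys i @[i --> \oo] --> p ->
    `|ys i - xs i|^-1 *: (ys i - xs i) @[i --> \oo] --> l ->
    cvg_subspace Vs T -> (l <= T)%MS.

Definition whitney_stratification (n s : nat) (A : set 'rV[R]_n)
    (S : 'I_s -> set 'rV[R]_n) (d : 'I_s -> nat) : Prop :=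
  [/\ A = \bigcup_l S l, trivIset setT S,
      forall l, submanifold (d l) (S l)
    & forall l l', l != l' -> whitney_b (d l') (S l) (S l')].

End Submanifolds.

Section LegendrianSingularities.
Variable R : realType.

Definition crit_zero (k q : nat) (F : 'rV[R]_(k + q) -> R) (x : 'rV[R]_k)
    (mu : 'rV[R]_q) : Prop :=
  F (row_mx x mu) = 0 /\
  forall i : 'I_k, pderiv (lshift q i) F (row_mx x mu) = 0.

(* F_j(x, mu), j < r, is an unfolding with parameter mu near b of the multigerm
   of hypersurface singularities f_j = F_j(-, b) at a_j, which is stable (in
   Mather's infinitesimal form): every multigerm (g_j) is congruent, modulo the
   Jacobian ideals (f_j, df_j/dx_1, ..., df_j/dx_k), to a real linear
   combination of the initial velocities (dF_j/dmu_l (-, b))_j, the same for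
   all the j. The value s of a map unfolding (x, mu) |-> (F(x, mu), mu) is
   counted among the parameters, i.e., one takes F(x, mu) - s; the discriminant
   of the unfolding is then the set of parameters mu such that some F_j(-, mu)
   is singular on its zero locus. *)
Definition stable_unfolding (r k q : nat) (F : 'I_r -> 'rV[R]_(k + q) -> R)
    (a : 'I_r -> 'rV[R]_k) (b : 'rV[R]_q) : Prop :=
  (forall j, smooth_at (row_mx (a j) b) (F j) /\ crit_zero (F j) (a j) b) /\
  forall g : 'I_r -> 'rV[R]_k -> R, (forall j, smooth_at (a j) (g j)) ->
    exists (c : 'rV[R]_q) (alpha : 'I_r -> 'rV[R]_k -> R)
           (beta : 'I_r -> 'I_k -> 'rV[R]_k -> R),
    forall j,
      [/\ smooth_at (a j) (alpha j), forall i, smooth_at (a j) (beta j i)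
        & \forall x \near a j,
            g j x = alpha j x * F j (row_mx x b)
                  + \sum_i beta j i x * pderiv (lshift q i) (F j) (row_mx x b)
                  + \sum_l c 0 l * pderiv (rshift k l) (F j) (row_mx x b)].

Definition discriminant_near (k q : nat) (F : 'rV[R]_(k + q) -> R)
    (a : 'rV[R]_k) (e : R) : set 'rV[R]_q :=
  [set mu | exists2 x, `|x - a| < e & crit_zero F x mu].

(* D represents the germ at z of the pull-back by h to Z of the discriminant of
   F at a. *)
Definition discriminant_germ (k q N : nat) (F : 'rV[R]_(k + q) -> R)
    (a : 'rV[R]_k) (Z : set 'rV[R]_N) (z : 'rV[R]_N)
    (h : 'rV[R]_N -> 'rV[R]_q) (D : set 'rV[R]_N) : Prop :=
  exists2 e0 : R, 0 < e0 & forall e, 0 < e < e0 ->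
    germ_eq z D (Z `&` h @^-1` discriminant_near F a e).

(* The germ at z of h : Z -> R^q, with Z a submanifold of dimension n, is a
   section transverse to the discriminant of the unfolding F, i.e., to a
   Whitney stratification of it in which the discriminant of each F_j is a
   union of strata. *)
Definition transverse_section (n N r k q : nat) (Z : set 'rV[R]_N)
    (z : 'rV[R]_N) (F : 'I_r -> 'rV[R]_(k + q) -> R) (a : 'I_r -> 'rV[R]_k)
    (b : 'rV[R]_q) (h : 'rV[R]_N -> 'rV[R]_q) : Prop :=
  [/\ smooth_at z h, h z = b
    & exists (D : 'I_r -> set 'rV[R]_q) (s : nat) (S : 'I_s -> set 'rV[R]_q)
             (d : 'I_s -> nat),
      [/\ forall j, discriminant_germ (F j) (a j) setT b id (D j),
          whitney_stratification (\bigcup_j D j) S d,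
          forall j l, (S l `&` D j) !=set0 -> S l `<=` D j
        & forall l T T',
            is_tangent_space (d l) (S l) b T -> is_tangent_space n Z z T' ->
            row_full (T + T' *m jac h z)%MS]].

(* The local components C_j at z of a set A contained in the n-dimensional
   manifold Z, when the singularity of A at z is a generic Legendrian one: the
   C_j are the pull-backs of the discriminants of the branches of a stable
   multigerm unfolding by a transverse section, and form a transverse union of
   Whitney stratified sets of pure dimension n - 1, with strata S_(j,l) of
   dimension d_(j,l), each having a unique limiting tangent space at z. At other
   singular points of C_j this may fail (C_j may have self-intersections there,
   as the swallowtail does), but these have their own local components. *)
Definition legendrian_components (n N r : nat) (Z A : set 'rV[R]_N)
    (z : 'rV[R]_N) (C : 'I_r -> set 'rV[R]_N) : Prop :=
  [/\ germ_eq z A (\bigcup_j C j), forall j, C j `<=` Z,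
      exists (k q : nat) (F : 'I_r -> 'rV[R]_(k + q) -> R)
             (a : 'I_r -> 'rV[R]_k) (b : 'rV[R]_q) (h : 'rV[R]_N -> 'rV[R]_q),
        [/\ stable_unfolding F a b, transverse_section n Z z F a b h
          & forall j, discriminant_germ (F j) (a j) Z z h (C j)],
      exists (s : nat) (S : 'I_r -> 'I_s -> set 'rV[R]_N)
             (d : 'I_r -> 'I_s -> nat),
        [/\ forall j, whitney_stratification (C j) (S j) (d j),
            forall j l, (d j l <= n.-1)%N,
            forall j, C j `<=` closure (\bigcup_(l in [set l | d j l = n.-1]) S j l)
          & forall (J : {set 'I_r}) (l : 'I_r -> 'I_s) (T : 'I_r -> 'M[R]_N) p,
              J != finset.set0 ->
              (forall j, j \in J -> is_tangent_space (d j (l j)) (S j (l j)) p (T j)) ->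
              (\rank (\bigcap_(j in J) T j)%MS
                 + \sum_(j in J) (n - \rank (T j)) = n)%N]
    & forall j, exists T, is_limiting_tangent_space n.-1 (C j) z T].

Definition only_generic_legendrian_singularities (n N : nat)
    (Z A : set 'rV[R]_N) : Prop :=
  forall z, A z -> ~ smooth_point n.-1 A z ->
    exists (r : nat) (C : 'I_r -> set 'rV[R]_N), legendrian_components n Z A z C.

End LegendrianSingularities.

(* From now on, m = n - 1. *)

Section Flow.
Variables (R : realType) (m : nat).

(* The point (v, c epsilon) = (v, c, c) of Minkowski space R^(n+2), and its
   components. *)
Definition hpoint (v : 'rV[R]_m.+1) (c : R) : 'rV[R]_(m.+1 + 2) :=
  row_mx v (c *: const_mx 1).

Definition normal_part (z : 'rV[R]_(m.+1 + 2)) : 'rV[R]_m.+1 := lsubmx z.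
Definition const_part (z : 'rV[R]_(m.+1 + 2)) : R := rsubmx z 0 0.

Definition hyperplane_space : set 'rV[R]_(m.+1 + 2) :=
  [set z | exists v c, dot v v = 1 /\ z = hpoint v c].

(* The Legendrian map x |-> T_x M is generated by the family of functions
   x |-> v . x - c on M, with parameter the hyperplane v . x = c. Its multigerm
   at distinct points where M is tangent to a given hyperplane is generic if
   this family is, at these points, induced from a stable unfolding by a section
   transverse to the discriminant. Both unit normals of a hyperplane give the
   same condition on v . x - c, so that working on S^(n-1) x R amounts to
   working in the dual projective space. *)
Definition generic_hypersurface (M : set 'rV[R]_m.+1) : Prop :=
  forall (z : 'rV[R]_(m.+1 + 2)) (r : nat) (U : 'I_r -> set 'rV[R]_m)
         (phi : 'I_r -> 'rV[R]_m -> 'rV[R]_m.+1) (a : 'I_r -> 'rV[R]_m),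
    hyperplane_space z ->
    (forall j, local_param M (U j) (phi j) /\ U j (a j)) ->
    injective (fun j => phi j (a j)) ->
    (forall j, dot (normal_part z) (phi j (a j)) = const_part z /\
       forall i, dot (normal_part z) (pderiv i (phi j) (a j)) = 0) ->
    exists (q : nat) (F : 'I_r -> 'rV[R]_(m + q) -> R) (b : 'rV[R]_q)
           (h : 'rV[R]_(m.+1 + 2) -> 'rV[R]_q),
      [/\ stable_unfolding F a b,
          transverse_section m.+1 hyperplane_space z F a b h
        & forall j, \forall u \near a j & w \near z, hyperplane_space w ->
            F j (row_mx u (h w)) = dot (normal_part w) (phi j u) - const_part w].

Definition lambda (x theta : R) : R :=
  if theta == 0 then x else sin (x * theta) / sin theta.

Definition sigma (x theta : R) : R :=
  if theta == 0 then 0 else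
  cos ((1 - x) * theta) / sin theta
    - (if x == 0 then theta^-1 else x / sin (x * theta)).

Definition relatively_oriented (M0 : set 'rV[R]_m.+1)
    (n0 n1 chi : 'rV[R]_m.+1 -> 'rV[R]_m.+1) (theta : 'rV[R]_m.+1 -> R) : Prop :=
  smooth_map m M0 theta /\
  forall x, M0 x -> - pi < theta x < pi /\
                    dot (n0 x) (n1 (chi x)) = cos (theta x).

Variables (n0 n1 chi : 'rV[R]_m.+1 -> 'rV[R]_m.+1) (theta : 'rV[R]_m.+1 -> R).

Definition flow_n (t : R) (x : 'rV[R]_m.+1) : 'rV[R]_m.+1 :=
  lambda t (theta x) *: n1 (chi x) + lambda (1 - t) (theta x) *: n0 x.

Definition flow_c (t : R) (x : 'rV[R]_m.+1) : R :=
  lambda t (theta x) * dot (n1 (chi x)) (chi x)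
    + lambda (1 - t) (theta x) * dot (n0 x) x.

Definition geodesic_flow (t : R) (x : 'rV[R]_m.+1) : 'rV[R]_(m.+1 + 2) :=
  hpoint (flow_n t x) (flow_c t x).

(* In what follows phi is a local parametrization u |-> x(u) of M0. *)

Definition corresponds (t : R) (phi : 'rV[R]_m -> 'rV[R]_m.+1) (u : 'rV[R]_m)
    (y : 'rV[R]_m.+1) : Prop :=
  dot (flow_n t (phi u)) y = flow_c t (phi u) /\
  forall i, dot (pderiv i (flow_n t \o phi) u) y = pderiv i (flow_c t \o phi) u.

(* The square matrix with columns f, f_(u_1), ..., f_(u_(n-1)). *)
Definition frame_mx (f : 'rV[R]_m -> 'rV[R]_m.+1) (u : 'rV[R]_m) : 'M[R]_m.+1 :=
  row_mx (f u)^T (jac f u)^T : 'M[R]_(m.+1, 1 + m).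

Definition dtheta_mx (phi : 'rV[R]_m -> 'rV[R]_m.+1) (u : 'rV[R]_m) :
    'M[R]_m.+1 :=
  row_mx 0 (\matrix_(i, j) (pderiv j (theta \o phi) u * n0 (phi u) 0 i))
    : 'M[R]_(m.+1, 1 + m).

Definition N'_mx (t : R) (phi : 'rV[R]_m -> 'rV[R]_m.+1) (u : 'rV[R]_m) :
    'M[R]_m.+1 :=
  lambda t (theta (phi u)) *: frame_mx (n1 \o chi \o phi) u
    + lambda (1 - t) (theta (phi u)) *: frame_mx (n0 \o phi) u
    + sigma t (theta (phi u)) *: dtheta_mx phi u.

(* (flow_n, - flow_c) in R^(n+1) *)
Definition flow_tilde (t : R) (x : 'rV[R]_m.+1) : 'rV[R]_m.+2 :=
  \row_i (if unlift ord_max i is Some k then flow_n t x 0 k else - flow_c t x).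

(* The cross product of the rows of A; see cross_prodP. *)
Definition cross_prod (n : nat) (A : 'M[R]_(n, n.+1)) : 'rV[R]_n.+1 :=
  \row_i \det (col_mx (delta_mx 0 i) A : 'M[R]_(1 + n)).

Definition h_tilde (t : R) (phi : 'rV[R]_m -> 'rV[R]_m.+1) (u : 'rV[R]_m) :
    'rV[R]_m.+2 :=
  cross_prod (col_mx (flow_tilde t (phi u)) (jac (flow_tilde t \o phi) u)
              : 'M[R]_(1 + m, m.+2)).

Definition hessian_mx (t : R) (phi : 'rV[R]_m -> 'rV[R]_m.+1) (u : 'rV[R]_m) :
    'M[R]_m :=
  \matrix_(i, j)
    dot (pderiv j (pderiv i (flow_tilde t \o phi)) u) (h_tilde t phi u).

End Flow.

Lemma cross_prodP (R : realType) (n : nat) (A : 'M[R]_(n, n.+1)) (v : 'rV[R]_n.+1) :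
  dot v (cross_prod A) = \det (col_mx v A : 'M[R]_(1 + n)).
Proof.
have rowE (w : 'rV[R]_n.+1) (j : 'I_n.+1) : (col_mx w A : 'M[R]_(1 + n)) 0 j = w 0 j.
  have -> : (0 : 'I_(1 + n)) = lshift n 0 by apply: val_inj.
  by rewrite col_mxEu.
have cofE (w : 'rV[R]_n.+1) (j : 'I_n.+1) :
    cofactor (col_mx w A : 'M[R]_(1 + n)) 0 j = cofactor (col_mx v A : 'M[R]_(1 + n)) 0 j.
  rewrite /cofactor; congr (_ * \det _); apply/matrixP => i k.
  rewrite mxE [RHS]mxE [LHS]mxE [RHS]mxE.
  have -> : lift (0 : 'I_(1 + n)) i = rshift 1 i by apply: val_inj.
  by rewrite !col_mxEd.
rewrite /dot (expand_det_row _ (0 : 'I_(1 + n))); apply: eq_bigr => i _.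
rewrite rowE mxE (expand_det_row _ (0 : 'I_(1 + n))) (bigD1 i) //= big1 => [|j ji].
  by rewrite rowE mxE !eqxx mul1r addr0 cofE.
by rewrite rowE mxE (negbTE ji) andbF mul0r.
Qed.

Section Envelope.
Variables (R : realType) (m : nat).

(* y lies on the envelope of a family of hyperplanes having, at z, the tangent
   space T in S^(n-1) x R: it is on the hyperplane z, and satisfies the
   equations obtained by differentiating along T. *)
Definition envelope_point (z : 'rV[R]_(m.+1 + 2)) (T : 'M[R]_(m.+1 + 2))
    (y : 'rV[R]_m.+1) : Prop :=
  dot (normal_part z) y = const_part z /\
  forall w : 'rV_(m.+1 + 2), (w <= T)%MS -> dot (normal_part w) y = const_part w.

(* The same at a possibly singular point z of a local component C, with its
   limiting tangent space. *)
Definition component_envelope_point (C : set 'rV[R]_(m.+1 + 2))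
    (z : 'rV[R]_(m.+1 + 2)) (y : 'rV[R]_m.+1) : Prop :=
  exists2 T, is_limiting_tangent_space m C z T & envelope_point z T y.

(* The projection of T on the space of normals is injective; otherwise, T
   contains the direction of the hyperplanes parallel to z, and the envelope
   point determined by T in projective space is at infinity. *)
Definition nonvertical (T : 'M[R]_(m.+1 + 2)) : Prop :=
  forall w : 'rV_(m.+1 + 2), (w <= T)%MS -> normal_part w = 0 -> w = 0.

End Envelope.

(* Main.v *)
Require Import Defs.
From HB Require Import structures.
From mathcomp Require Import all_boot all_order all_algebra.
From mathcomp Require Import all_classical all_reals all_analysis.
From mathcomp Require Import ring lra.
Set Implicit Arguments.
Unset Strict Implicit.
Unset Printing Implicit Defensive.
Import Order.TTheory GRing.Theory Num.Theory.
Import numFieldNormedType.Exports.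
Local Open Scope classical_set_scope.
Local Open Scope ring_scope.

(** A point [y] corresponds to [u] when it solves the linear system whose matrix
    has rows [n_t, n_(t,u_1), ..., n_(t,u_m)]. Since [d n_t / d theta] equals
    [mu n_t + sigma n_0] for some scalar [mu], this matrix and the transpose of
    [N'_t] differ by adding multiples of the first row to the others, hence (1).

    For (2), the solution is [h~ / h~_last] by the orthogonality of the cross
    product. Differentiating [n~_(u_i) . (y, 1) = 0] gives
    [n_(u_i) . y_(u_j) = - (H . h~)_(ij) / h~_last], so that [y] is an immersion
    when the Hessian is nonsingular. Immersions are locally bi-Lipschitz by the
    mean value theorem, which yields local parametrizations of their images
    without the inverse function theorem.

    For (3), the equations of the tangent spaces at smooth points converge to
    those of the limiting tangent space, which form an invertible system because
    it is nonvertical and orthogonal to the normal of [z]. *)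

(** * Differential calculus *)

Section Calculus.
Variable R : realType.

(** Smoothness along a hypersurface is expressed only through composition with its local
    parametrizations, so even the smoothness of [n1 \o chi \o phi] requires [chi \o phi] to be a
    local parametrization of [M1]. The inverse of [chi] is likewise smooth only along [M1] and has
    no ambient derivative; what is extracted from it is a Lipschitz bound between points of [M1].
    Such bounds stand in for inverse derivatives: when increments of f dominate those of g, the
    kernel of df lies in that of dg, and the same kind of estimate gives openness onto the image. A
    second obstacle is the removable singularity of [lambda] at theta = 0. Writing sin x = x sinc x,
    with sinc an entire power series, turns [lambda] into a quotient whose denominator has no zero
    on (-pi, pi). Matrices carry the sup norm, for which a product costs a factor equal to the inner
    dimension; this is the origin of the integer factors in the estimates. *)

Lemma normr_entry_le (p q : nat) (A : 'M[R]_(p, q)) i j : `|A i j| <= `|A|.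
Proof.
by rewrite [leRHS]/Num.Def.normr/= mx_normrE (le_bigmax _ (fun ij => `|A ij.1 ij.2|) (i, j)).
Qed.

Lemma mx_norm_le (p q : nat) (A : 'M[R]_(p, q)) e :
  0 <= e -> (forall i j, `|A i j| <= e) -> `|A| <= e.
Proof.
by move=> e0 Ae; rewrite /Num.Def.normr/= mx_normrE (bigmax_le _ e0).
Qed.

Lemma cvg_mxP (T : Type) (F : set_system T) (FF : Filter F) (p q : nat)
    (f : T -> 'M[R]_(p, q)) (A : 'M[R]_(p, q)) :
  f x @[x --> F] --> A <-> forall i j, f x i j @[x --> F] --> A i j.
Proof.
split=> [/cvgrPdist_le fA i j|fA].
  apply/cvgrPdist_le => e e0; apply: filterS (fA e e0) => x.
  by apply: le_trans; have := normr_entry_le (A - f x) i j; rewrite !mxE.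
apply/cvgrPdist_le => e e0.
have : \forall x \near F, forall i j, `|A i j - f x i j| <= e.
  apply: filter_forall => i; apply: filter_forall => j.
  by move/cvgrPdist_le: (fA i j); apply.
by apply: filterS => x H; apply: mx_norm_le (ltW e0) _ => i j; rewrite !mxE.
Qed.

Lemma norm_mulmx_le (p q r : nat) (A : 'M[R]_(p, q)) (B : 'M[R]_(q, r)) :
  `|A *m B| <= q%:R * `|B| * `|A|.
Proof.
apply: mx_norm_le => [|i j]; first by rewrite !mulr_ge0.
rewrite mxE (le_trans (ler_norm_sum _ _ _))//.
rewrite (@le_trans _ _ (\sum_(k < q) `|A| * `|B|))//.
  apply: ler_sum => k _; by rewrite normrM; apply: ler_pM; rewrite ?normr_entry_le.
by rewrite sumr_const card_ord -[leLHS]mulr_natl -mulrA [`|B| * _]mulrC.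
Qed.

Lemma cvg_mulmxr (T : Type) (F : set_system T) (FF : Filter F) (p q r : nat)
    (f : T -> 'M[R]_(p, q)) (A : 'M[R]_(p, q)) (B : 'M[R]_(q, r)) :
  f x @[x --> F] --> A -> f x *m B @[x --> F] --> A *m B.
Proof.
move=> /cvg_mxP fA; apply/cvg_mxP => i j; rewrite mxE.
under eq_cvg do rewrite mxE.
apply: cvg_big => [|k _]; first exact: add_continuous.
by apply: cvgMr_tmp; exact: fA.
Qed.

Lemma cvg_det (T : Type) (F : set_system T) (FF : Filter F) (n : nat)
    (f : T -> 'M[R]_n) (A : 'M[R]_n) :
  f x @[x --> F] --> A -> \det (f x) @[x --> F] --> \det A.
Proof.
move=> /cvg_mxP fA; rewrite /determinant; apply: cvg_big => [|s _].
  exact: add_continuous.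
apply: cvgMl_tmp; apply: cvg_big => [|i _]; first exact: mul_continuous.
exact: fA.
Qed.

Section Diff.
Variables V W : normedModType R.
Implicit Types (f g : V -> W) (x v : V).

Lemma differentiable_near_le f x : differentiable f x -> forall e, 0 < e ->
  \forall h \near 0, `|f (h + x) - f x - 'd f x h| <= e * `|h|.
Proof.
by move=> /diff_locally /eqaddoP H e /H; apply: filterS => h; rewrite !fctE opprD addrA.
Qed.

Lemma differentiable_of_near_le f x (L : {linear V -> W}) : continuous L ->
  (forall e, 0 < e -> \forall h \near 0, `|f (h + x) - f x - L h| <= e * `|h|) ->
  differentiable f x.
Proof.
move=> Lc fL.
have E : f \o shift x = cst (f x) + L +o_ 0 id.
  apply/eqaddoP => e /fL; apply: filterS => h.
  by rewrite !fctE opprD addrA.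
have dE : 'd f x = L :> (V -> W) by apply: diff_unique.
by apply/diff_locallyP; rewrite dE.
Qed.

Lemma near_eq_differentiable f g x : {near x, f =1 g} ->
  differentiable f x -> differentiable g x.
Proof.
move=> fg df; apply: (@differentiable_of_near_le _ _ ('d f x)).
  exact: diff_continuous.
move=> e e0.
move: fg; rewrite (near_shift 0)/= => fg.
have fgx : f x = g x by have := nbhs_singleton fg; rewrite /= subr0 add0r.
by apply: filterS2 fg (differentiable_near_le df e0) => h /=; rewrite subr0 fgx => ->.
Qed.

End Diff.

Lemma differentiable_mxP (V : normedModType R) (p q : nat) (f : V -> 'M[R]_(p, q)) x :
  differentiable f x <-> forall i j, differentiable (fun y => f y i j) x.
Proof.
split=> [df i j|df].
  exact: (differentiable_comp df (differentiable_coord _ _ _)).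
have -> : f = \sum_i (\sum_j (fun y => f y i j *: delta_mx i j)).
  apply/funext => y; rewrite [LHS]matrix_sum_delta fct_sumE.
  by apply: eq_bigr => i _; rewrite fct_sumE.
apply: differentiable_sum => i; apply: differentiable_sum => j.
exact: differentiableZl.
Qed.

Lemma derive_entry (V : normedModType R) (p q : nat) (f : V -> 'M[R]_(p, q)) x v i j :
  differentiable f x -> ('D_v f x) i j = 'D_v (fun y => f y i j) x.
Proof. by move=> df; rewrite derive_mx ?mxE//; exact: diff_derivable. Qed.

Lemma jacE (m n : nat) (f : 'rV[R]_m -> 'rV[R]_n) x i : row i (jac f x) = pderiv i f x.
Proof. by apply/rowP => j; rewrite !mxE. Qed.

Lemma diff_jac (m n : nat) (f : 'rV[R]_m -> 'rV[R]_n) x v :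
  differentiable f x -> 'd f x v = v *m jac f x.
Proof.
move=> df; rewrite {1}(row_sum_delta v) linear_sum mulmx_sum_row.
by apply: eq_bigr => i _; rewrite linearZ jacE /pderiv deriveE.
Qed.

Lemma differentiable_mulmxr (m n p : nat) (f : 'rV[R]_m -> 'rV[R]_n) (K : 'M[R]_(n, p)) x :
  differentiable f x -> differentiable (fun y => f y *m K) x.
Proof.
move=> df; apply/differentiable_mxP => i j.
have -> : (fun y => (f y *m K) i j) = \sum_k (fun y => K k j *: f y i k).
  by apply/funext => v; rewrite mxE fct_sumE; apply: eq_bigr => k _; rewrite [RHS]mulrC.
apply: differentiable_sum => k; apply: differentiableZ.
by move/differentiable_mxP: df; exact.
Qed.

Lemma jac_mulmxr (m n p : nat) (f : 'rV[R]_m -> 'rV[R]_n) (K : 'M[R]_(n, p)) x :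
  differentiable f x -> jac (fun y => f y *m K) x = jac f x *m K.
Proof.
move=> df; have dfK := differentiable_mulmxr K df.
have df' i k : derivable (fun y => f y 0 k) x (delta_mx 0 i).
  by apply: diff_derivable; move/differentiable_mxP: df; exact.
apply/matrixP => i j; rewrite !mxE /pderiv derive_entry//.
have -> : (fun y => (f y *m K) 0 j) = \sum_k (fun y => K k j *: f y 0 k).
  by apply/funext => v; rewrite mxE fct_sumE; apply: eq_bigr => k _; rewrite [RHS]mulrC.
rewrite derive_sum => [|k]; last exact: derivableZ.
by apply: eq_bigr => k _; rewrite deriveZ// mxE -derive_entry// [LHS]mulrC.
Qed.

End Calculus.

(** * Smooth maps *)

Section Smooth.
Variables (R : realType) (m : nat).
Implicit Types (U : set 'rV[R]_m) (V W : normedModType R).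

(* Unlike [smooth_on], this allows closure properties to be proved by induction
   on [k]: a derivative of [f * g] involves products one order lower. *)
Fixpoint class_C (V : normedModType R) (k : nat) U (f : 'rV[R]_m -> V) : Prop :=
  if k is k'.+1 then
    (forall x, U x -> differentiable f x) /\ forall i, class_C k' U (pderiv i f)
  else True.

(** The head of the word [s] is the outermost derivative, whereas [class_C] takes the innermost one
    first; words are therefore decomposed from their last letter. *)
Lemma smooth_onP V U (f : 'rV[R]_m -> V) : smooth_on U f <-> forall k, class_C k U f.
Proof.
split=> [sf k|Cf s x Ux].
  elim: k f sf => //= k IH f sf; split=> [x|i]; first exact: (sf [::]).
  by apply: IH => s x Ux; have := sf (rcons s i) x Ux; rewrite foldr_rcons.
elim/last_ind: s f Cf => [|s i IH] f Cf; first exact: (Cf 1%N).1.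
by rewrite foldr_rcons; apply: IH => k; exact: (Cf k.+1).2.
Qed.

Lemma class_CS V k U (f : 'rV[R]_m -> V) : class_C k.+1 U f -> class_C k U f.
Proof.
elim: k f => //= k IH f [df Cf]; split=> // i; exact: IH (Cf i).
Qed.

Lemma eq_in_pderiv V U (f g : 'rV[R]_m -> V) i : open U -> (forall x, U x -> f x = g x) ->
  forall x, U x -> pderiv i f x = pderiv i g x.
Proof.
move=> oU fg x Ux; apply: near_eq_derive.
by apply: filterS (open_nbhs_nbhs (conj oU Ux)) => y; exact: fg.
Qed.

(** Product and quotient rules hold only at the points of [U], where the factors are differentiable.
    Since [U] is open, such equalities on [U] can be differentiated again. *)
Lemma eq_class_C V k U (f g : 'rV[R]_m -> V) : open U ->
  (forall x, U x -> f x = g x) -> class_C k U f -> class_C k U g.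
Proof.
move=> oU; elim: k f g => //= k IH f g fg [df Cf]; split=> [x Ux|i].
  apply: near_eq_differentiable (df _ Ux).
  by apply: filterS (open_nbhs_nbhs (conj oU Ux)) => y; exact: fg.
exact: IH (eq_in_pderiv i oU fg) (Cf i).
Qed.

Lemma eq_smooth_on V U (f g : 'rV[R]_m -> V) : open U ->
  (forall x, U x -> f x = g x) -> smooth_on U f -> smooth_on U g.
Proof. by move=> oU fg /smooth_onP sf; apply/smooth_onP => k; exact: eq_class_C fg (sf k). Qed.

Lemma sub_smooth_on V U U' (f : 'rV[R]_m -> V) : U' `<=` U -> smooth_on U f -> smooth_on U' f.
Proof. by move=> U'U sf s x /U'U; exact: sf. Qed.

Lemma smooth_on_differentiable V U (f : 'rV[R]_m -> V) x :
  smooth_on U f -> U x -> differentiable f x.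
Proof. by move=> sf; exact: (sf [::]). Qed.

Lemma smooth_on_pderiv V U (f : 'rV[R]_m -> V) i : smooth_on U f -> smooth_on U (pderiv i f).
Proof. by move=> /smooth_onP sf; apply/smooth_onP => k; exact: (sf k.+1).2. Qed.

Lemma class_C_cst V k U (c : V) : class_C k U (fun _ : 'rV[R]_m => c).
Proof.
elim: k c => //= k IH c; split=> [x _|i]; first exact: differentiable_cst.
by rewrite (_ : pderiv i _ = fun _ => 0)//; apply/funext => x; exact: derive_cst.
Qed.

Lemma class_CD V k U (f g : 'rV[R]_m -> V) : open U ->
  class_C k U f -> class_C k U g -> class_C k U (fun x => f x + g x).
Proof.
move=> oU; elim: k f g => //= k IH f g [df Cf] [dg Cg]; split=> [x Ux|i].
  by apply: differentiableD; [exact: df|exact: dg].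
apply: eq_class_C (IH _ _ (Cf i) (Cg i)) => // x Ux.
by rewrite /pderiv deriveD//; apply: diff_derivable; [exact: df|exact: dg].
Qed.

Lemma class_CM k U (f g : 'rV[R]_m -> R) : open U ->
  class_C k U f -> class_C k U g -> class_C k U (fun x => f x * g x).
Proof.
move=> oU; elim: k f g => // k IH f g Cf Cg; have [df Cf'] := Cf; have [dg Cg'] := Cg.
split=> [x Ux|i]; first by apply: differentiableM; [exact: df|exact: dg].
apply: (@eq_class_C _ _ _ (fun x => f x * pderiv i g x + g x * pderiv i f x)) => //.
  by move=> x Ux; rewrite /pderiv deriveM//; apply: diff_derivable; [exact: df|exact: dg].
exact: class_CD oU (IH _ _ (class_CS Cf) (Cg' i)) (IH _ _ (class_CS Cg) (Cf' i)).
Qed.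

Lemma class_CV k U (f : 'rV[R]_m -> R) : open U -> (forall x, U x -> f x != 0) ->
  class_C k U f -> class_C k U (fun x => (f x)^-1).
Proof.
move=> oU f0; elim: k f f0 => // k IH f f0 Cf; have [df Cf'] := Cf.
split=> [x Ux|i]; first by apply: differentiableV; [exact: df|exact: f0].
apply: (@eq_class_C _ _ _ (fun x => (-1 * ((f x)^-1 * (f x)^-1)) * pderiv i f x)) => //.
  move=> x Ux; rewrite /pderiv deriveV//; [|exact: f0|exact: diff_derivable (df _ Ux)].
  by rewrite expr2 invfM mulN1r.
have CfV : class_C k U (fun x => (f x)^-1) by apply: IH => //; exact: class_CS.
exact: class_CM oU (class_CM oU (class_C_cst k U (-1 : R)) (class_CM oU CfV CfV)) (Cf' i).
Qed.

Lemma class_C_sum V k U (I : Type) (r : seq I) (P : pred I) (F : I -> 'rV[R]_m -> V) :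
  open U -> (forall i, class_C k U (F i)) ->
  class_C k U (fun x => \sum_(i <- r | P i) F i x).
Proof.
move=> oU CF; elim: r => [|i r IH].
  by apply: (eq_class_C oU _ (class_C_cst k U 0)) => x; rewrite big_nil.
case Pi : (P i); last by apply: (eq_class_C oU _ IH) => x _; rewrite big_cons Pi.
by apply: (eq_class_C oU _ (class_CD oU (CF i) IH)) => x _; rewrite big_cons Pi.
Qed.

Lemma class_C_prod k U (I : Type) (r : seq I) (P : pred I) (F : I -> 'rV[R]_m -> R) :
  open U -> (forall i, class_C k U (F i)) ->
  class_C k U (fun x => \prod_(i <- r | P i) F i x).
Proof.
move=> oU CF; elim: r => [|i r IH].
  by apply: (eq_class_C oU _ (class_C_cst k U (1 : R))) => x; rewrite big_nil.
case Pi : (P i); last by apply: (eq_class_C oU _ IH) => x _; rewrite big_cons Pi.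
by apply: (eq_class_C oU _ (class_CM oU (CF i) IH)) => x _; rewrite big_cons Pi.
Qed.

Lemma class_C_mxP k U p q (f : 'rV[R]_m -> 'M[R]_(p, q)) : open U ->
  class_C k U f <-> forall i j, class_C k U (fun x => f x i j).
Proof.
move=> oU; elim: k f => [//|k IH] f; split=> [[df Cf] i j|Cf].
  split=> [x /df/differentiable_mxP|l]; first exact.
  have /IH := Cf l; move=> /(_ i j); apply: eq_class_C => // x Ux.
  by rewrite /pderiv derive_entry//; exact: df.
have df x : U x -> differentiable f x.
  by move=> Ux; apply/differentiable_mxP => i j; exact: (Cf i j).1.
split=> // l; apply/IH => i j; apply: (eq_class_C oU _ ((Cf i j).2 l)) => x Ux.
by rewrite /pderiv derive_entry//; exact: df.
Qed.

Lemma smooth_on_mxP U p q (f : 'rV[R]_m -> 'M[R]_(p, q)) : open U ->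
  smooth_on U f <-> forall i j, smooth_on U (fun x => f x i j).
Proof.
move=> oU; split=> [/smooth_onP Cf i j|Cf]; apply/smooth_onP => k.
  by have /class_C_mxP := Cf k; exact.
by apply/class_C_mxP => // i j; have /smooth_onP := Cf i j; exact.
Qed.

Lemma smooth_on_cst V U (c : V) : smooth_on U (fun _ : 'rV[R]_m => c).
Proof. by apply/smooth_onP => k; exact: class_C_cst. Qed.

Lemma smooth_onD V U (f g : 'rV[R]_m -> V) : open U ->
  smooth_on U f -> smooth_on U g -> smooth_on U (fun x => f x + g x).
Proof.
by move=> oU /smooth_onP Cf /smooth_onP Cg; apply/smooth_onP => k; exact: class_CD.
Qed.

Lemma smooth_onM U (f g : 'rV[R]_m -> R) : open U ->
  smooth_on U f -> smooth_on U g -> smooth_on U (fun x => f x * g x).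
Proof.
by move=> oU /smooth_onP Cf /smooth_onP Cg; apply/smooth_onP => k; exact: class_CM.
Qed.

Lemma smooth_onV U (f : 'rV[R]_m -> R) : open U -> (forall x, U x -> f x != 0) ->
  smooth_on U f -> smooth_on U (fun x => (f x)^-1).
Proof.
by move=> oU f0 /smooth_onP Cf; apply/smooth_onP => k; exact: class_CV.
Qed.

Lemma smooth_on_sum V U (I : Type) (r : seq I) (P : pred I) (F : I -> 'rV[R]_m -> V) :
  open U -> (forall i, smooth_on U (F i)) ->
  smooth_on U (fun x => \sum_(i <- r | P i) F i x).
Proof.
move=> oU CF; apply/smooth_onP => k; apply: class_C_sum => // i.
by have /smooth_onP := CF i; exact.
Qed.

Lemma smooth_on_det U p (f : 'rV[R]_m -> 'M[R]_p) : open U ->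
  smooth_on U f -> smooth_on U (fun x => \det (f x)).
Proof.
move=> oU /(smooth_on_mxP _ oU) sf; apply: smooth_on_sum => // s.
apply: smooth_onM => //; first exact: smooth_on_cst.
apply/smooth_onP => k; apply: class_C_prod => // i.
by have /smooth_onP := sf i (perm.fun_of_perm s i); exact.
Qed.

Lemma smooth_onZ U p q (f : 'rV[R]_m -> R) (g : 'rV[R]_m -> 'M[R]_(p, q)) : open U ->
  smooth_on U f -> smooth_on U g -> smooth_on U (fun x => f x *: g x).
Proof.
move=> oU sf sg; apply/smooth_on_mxP => // i j.
apply: (@eq_smooth_on _ _ (fun x => f x * g x i j)) => // [x _|]; first by rewrite mxE.
by apply: smooth_onM => //; move/smooth_on_mxP: sg; exact.
Qed.

Lemma smooth_on_dot U p (f g : 'rV[R]_m -> 'rV[R]_p) : open U ->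
  smooth_on U f -> smooth_on U g -> smooth_on U (fun x => dot (f x) (g x)).
Proof.
move=> oU sf sg; apply: smooth_on_sum => // i.
by apply: smooth_onM => //; [move/smooth_on_mxP: sf|move/smooth_on_mxP: sg]; exact.
Qed.

End Smooth.

(** * The functions lambda and sigma *)

Section Lambda.
Variable R : realType.
Implicit Types (a : R^nat) (t th : R).

(** A class of entire power series stable under formal differentiation: the factor n+1 is absorbed
    by the factorial. *)
Definition exp_dominated a := forall n, `|a n| <= n`!%:R^-1.

Definition psum a (x : R) : R := limn (pseries a x).

Lemma exp_dominated_diffs a : exp_dominated a -> exp_dominated (pseries_diffs a).
Proof.
move=> ha n; rewrite /pseries_diffs normrM normr_nat.
rewrite (@le_trans _ _ (n.+1%:R * n.+1`!%:R^-1))//; first by rewrite ler_wpM2l.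
by rewrite factS natrM invfM mulVKf.
Qed.

Lemma is_cvg_pseries_exp a (x : R) : exp_dominated a -> cvgn (pseries a x).
Proof.
move=> ha; apply: normed_cvg.
apply: series_le_cvg; last exact: (is_cvg_series_exp_coeff `|x|).
- by move=> n; rewrite normr_ge0.
- by move=> n; rewrite divr_ge0.
- move=> n /=; rewrite /exp_coeff /= normrM normrX mulrC.
  by rewrite ler_wpM2l// exprn_ge0.
Qed.

Lemma is_derive_psum a (x : R) : exp_dominated a ->
  is_derive x (1 : R) (psum a) (psum (pseries_diffs a) x).
Proof.
move=> ha; have h1 := exp_dominated_diffs ha; have h2 := exp_dominated_diffs h1.
(* Term-by-term differentiation needs the series and its first two formal derivatives to converge at
   a point farther from 0 than [x]. *)
apply: (@pseries_snd_diffs _ _ (`|x| + 1)); do ?exact: is_cvg_pseries_exp.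
by rewrite [ltRHS]ger0_norm ?ltrDl// addr_ge0.
Qed.

Lemma psum0 a : psum a 0 = a 0%N.
Proof.
rewrite /psum; apply: lim_near_cst => //; near=> n.
rewrite -[n]prednK; last by near: n.
rewrite /pseries /series /= big_nat_recl//= expr0 mulr1 big1 ?addr0// => i _.
by rewrite expr0n mulr0.
Unshelve. all: by end_near. Qed.

(** The chain rule yields [psum (pseries_diffs a)] in place of [psum a], so the induction on [k] is
    carried out for all dominated [a] at once. *)
Lemma class_C_psum (m : nat) k (U : set 'rV[R]_m) a (f : 'rV[R]_m -> R) :
  open U -> exp_dominated a -> class_C k U f -> class_C k U (fun y => psum a (f y)).
Proof.
move=> oU; elim: k a f => // k IH a f ha Cf; have [df Cf'] := Cf.
have dp z : differentiable (psum a) z.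
  by apply/derivable1_diffP; have [] := is_derive_psum z ha.
split=> [x Ux|i].
  by apply: (@differentiable_comp _ _ _ _ f (psum a)) => //; exact: df.
have /(class_CM oU)/(_ (Cf' i)) := IH _ _ (exp_dominated_diffs ha) (class_CS Cf).
apply: eq_class_C => // x Ux; have dfx := df _ Ux.
rewrite /pderiv [RHS]deriveE; last exact: (@differentiable_comp _ _ _ _ f (psum a)).
rewrite (@diff_comp _ _ _ _ f (psum a))//= deriv1E; last by have [] := is_derive_psum (f x) ha.
rewrite derive1E (@derive_val _ _ _ _ _ _ _ (is_derive_psum (f x) ha)).
by rewrite deriveE// mulrC.
Qed.

(** The Taylor coefficients of sin x / x, that is, those of sin shifted by one place. *)
Definition sinc_coeff (n : nat) : R := (~~ odd n)%:R * (-1) ^+ n./2 * n.+1`!%:R^-1.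

Definition sinc := psum sinc_coeff.

Lemma sinc_coeff_dominated : exp_dominated sinc_coeff.
Proof.
move=> n; rewrite /sinc_coeff !normrM normrX normrN1 expr1n mulr1 normr_nat.
rewrite normfV normr_nat.
rewrite (@le_trans _ _ n.+1`!%:R^-1)//.
  by rewrite -[leRHS]mul1r ler_wpM2r// lern1 leq_b1.
by rewrite lef_pV2 ?posrE ?ltr0n ?fact_gt0// ler_nat factS leq_pmull.
Qed.

Lemma sin_sinc (x : R) : sin x = x * sinc x.
Proof.
rewrite sinE; apply/cvg_lim => //; rewrite -cvg_shiftS /=.
have cx : x * pseries sinc_coeff x n @[n --> \oo] --> x * sinc x.
  have c : pseries sinc_coeff x n @[n --> \oo] --> sinc x.
    exact: is_cvg_pseries_exp sinc_coeff_dominated.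
  exact: cvgM (cvg_cst x) c.
rewrite (_ : (fun n => _) = (fun n => x * pseries sinc_coeff x n))//.
(* The constant term of the sine series is zero; the others each release one factor [x]. *)
apply/funext => n; rewrite /pseries /series /= big_nat_recl//= mul0r !mul0r add0r mulr_sumr.
by apply: eq_bigr => i _; rewrite /sinc_coeff exprS; ring.
Qed.

Lemma sinc0 : sinc 0 = 1.
Proof. by rewrite /sinc psum0 /sinc_coeff /= expr0 !mul1r invr1. Qed.

Lemma derive_sinc0 : is_derive (0 : R) (1 : R) sinc 0.
Proof.
apply: is_derive_eq (is_derive_psum 0 sinc_coeff_dominated) _.
by rewrite psum0 /pseries_diffs /sinc_coeff /= !mul0r mulr0.
Qed.

Lemma sin_neq0 th : th != 0 -> - pi < th < pi -> sin th != 0.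
Proof.
move=> th0 /andP[h1 h2]; have [th_gt|th_lt|th_eq] := ltrgt0P th.
- by rewrite gt_eqF// sin_gt0_pi// th_gt.
- by rewrite -oppr_eq0 -sinN gt_eqF// sin_gt0_pi// oppr_gt0 th_lt ltrNl.
- by rewrite th_eq eqxx in th0.
Qed.

Lemma sinc_neq0 th : - pi < th < pi -> sinc th != 0.
Proof.
have [->|th0] := eqVneq th 0; first by rewrite sinc0 oner_eq0.
by move=> /(sin_neq0 th0); rewrite sin_sinc mulf_eq0 negb_or => /andP[].
Qed.

(** As sinc 0 = 1, this one formula covers theta = 0 as well, and smoothness in theta can be read
    off from it. *)
Lemma lambdaE t th : - pi < th < pi -> lambda t th = t * sinc (t * th) * (sinc th)^-1.
Proof.
move=> hth; rewrite /lambda; have [->|th0] := eqVneq th 0.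
  by rewrite mulr0 sinc0 invr1 !mulr1.
have s0 := sinc_neq0 hth.
by rewrite !sin_sinc; field; rewrite th0 s0.
Qed.

Lemma smooth_on_lambda (m : nat) (U : set 'rV[R]_m) t (f : 'rV[R]_m -> R) :
  open U -> (forall x, U x -> - pi < f x < pi) -> smooth_on U f ->
  smooth_on U (fun x => lambda t (f x)).
Proof.
move=> oU fpi sf.
apply: (@eq_smooth_on _ _ _ _ (fun x => t * sinc (t * f x) * (sinc (f x))^-1)) => //.
  by move=> x Ux; rewrite lambdaE// fpi.
have ssinc (g : 'rV[R]_m -> R) : smooth_on U g -> smooth_on U (fun x => sinc (g x)).
  move=> /smooth_onP sg; apply/smooth_onP => k.
  exact: class_C_psum sinc_coeff_dominated (sg k).
have st := @smooth_on_cst _ m _ U t.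
apply: smooth_onM => //; last first.
  by apply: smooth_onV => //; [move=> x Ux; apply: sinc_neq0; exact: fpi|exact: ssinc].
by apply: smooth_onM => //; apply: ssinc; apply: smooth_onM.
Qed.

(** Serves with [p] equal to [sinc] at theta = 0 and equal to [sin] elsewhere. *)
Lemma is_derive_quotient (p : R -> R) (a b s th : R) :
  is_derive (s * th) (1 : R) p a -> is_derive th (1 : R) p b -> p th != 0 ->
  is_derive th (1 : R) (fun y => p (s * y) / p y)
    ((s * a * p th - p (s * th) * b) / p th ^+ 2).
Proof.
move=> pa pb p0.
have ds : is_derive th (1 : R) (fun y => s * y) s.
  by apply: is_derive_eq; rewrite [LHS]mulr1.
have dn : is_derive th (1 : R) (p \o (fun y => s * y)) (a * s) by exact: is_derive1_comp.
have dV := is_deriveV p0 pb.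
apply: is_derive_eq (is_deriveM dn dV) _.
rewrite /GRing.scale /=; field.
exact: p0.
Qed.

(* Differentiating the geodesic in theta gives a combination of its current
   point and of its initial point, the latter with coefficient sigma. *)
Lemma is_derive_lambda t th : - pi < th < pi -> 0 <= t <= 1 ->
  exists2 mu, is_derive th (1 : R) (lambda t) (mu * lambda t th)
    & is_derive th (1 : R) (lambda (1 - t)) (mu * lambda (1 - t) th + sigma t th).
Proof.
move=> hth /andP[t0 t1].
have nth : \forall y \near th, - pi < y < pi.
  have := @near_in_itvoo R (- pi) pi th; rewrite in_itv /= => /(_ hth).
  by apply: filterS => y; rewrite in_itv.
have [th0|th0] := eqVneq th 0.
  (* The derivative of sinc vanishes at 0, so every [lambda s] is stationary there; as sigma is 0
     too, [mu] = 0 fits. *)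
  have D s : is_derive th (1 : R) (lambda s) 0.
    apply: (@near_eq_is_derive _ _ _ (fun y => s * (sinc (s * y) / sinc y))).
      by apply: filterS nth => y /lambdaE ->; rewrite mulrA.
    have d0 : is_derive (s * th) (1 : R) sinc 0 by rewrite th0 mulr0; exact: derive_sinc0.
    have d1 : is_derive th (1 : R) sinc 0 by rewrite th0; exact: derive_sinc0.
    have := is_derive_quotient d0 d1 (sinc_neq0 hth).
    rewrite !mulr0 mul0r subrr mul0r => d2.
    by apply: is_derive_eq; rewrite [LHS]mulr0.
  by exists 0; rewrite !mul0r// add0r /sigma th0 eqxx -[X in is_derive X]th0.
have S0 := sin_neq0 th0 hth.
have D s : is_derive th (1 : R) (lambda s)
    ((s * cos (s * th) * sin th - sin (s * th) * cos th) / sin th ^+ 2).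
  apply: (@near_eq_is_derive _ _ _ (fun y => sin (s * y) / sin y)).
    near=> y; rewrite /lambda ifF//; apply/negbTE; near: y.
    by apply: (cvgr_neq0 th).
  exact: is_derive_quotient.
(* For t = 0 the first function is identically zero and the second is constantly 1 near [th], which
   forces [mu] = - sigma. *)
have [->|tn0] := eqVneq t 0.
  exists (- sigma 0 th); apply: is_derive_eq (D _) _.
    by rewrite /lambda (negbTE th0) !mul0r sin0 !mul0r subrr mul0r mulr0.
  rewrite subr0 !mul1r /lambda (negbTE th0) mul1r divff// mulr1 addNr.
  by rewrite [cos th * _]mulrC subrr mul0r.
have st0 : sin (t * th) != 0.
  apply: sin_neq0; first by rewrite mulf_neq0.
  rewrite -ltr_norml normrM (ger0_norm t0) (@le_lt_trans _ _ `|th|)//.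
    by rewrite ler_piMl.
  by rewrite ltr_norml.
(* The first equation forces [mu] to be the logarithmic derivative of [lambda t] in theta. The
   second then reduces to the addition formula for sin (t theta + (1 - t) theta). *)
exists (t * cos (t * th) / sin (t * th) - cos th / sin th); apply: is_derive_eq (D _) _.
  by rewrite /lambda (negbTE th0); field; rewrite S0 st0.
have E : sin th = sin (t * th) * cos ((1 - t) * th) + cos (t * th) * sin ((1 - t) * th).
  by rewrite -sinD; congr sin; ring.
rewrite /lambda /sigma (negbTE th0) (negbTE tn0).
apply/eqP; rewrite -subr_eq0; apply/eqP.
move: (sin (t * th)) (cos (t * th)) (sin ((1 - t) * th)) (cos ((1 - t) * th)) (sin th)
  (cos th) S0 st0 E => sa ca sb cb S C S0 sa0 E.
rewrite (_ : _ - _ = t * (S - (sa * cb + ca * sb)) / (sa * S)).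
  by rewrite -E subrr mulr0 mul0r.
by field; rewrite S0 sa0.
Unshelve. all: by end_near. Qed.

End Lambda.

(** * Immersions *)

Section Immersions.
Variable R : realType.

Lemma mean_value (m : nat) (f : 'rV[R]_m -> R) (u x y : 'rV[R]_m) (r : R) :
  (forall z, ball u r z -> differentiable f z) -> ball u r x -> ball u r y ->
  exists2 z, ball u r z & f y - f x = 'd f z (y - x).
Proof.
move=> df ux uy.
pose p (s : R) := s *: (y - x) + x.
have bp (s : R) : s \in `[0, 1] -> ball u r (p s).
  rewrite in_itv /= => /andP[s0 s1]; move: ux uy; rewrite -!ball_normE /ball_ /= => ux uy.
  rewrite /p (_ : u - _ = s *: (u - y) + (1 - s) *: (u - x)); last first.
    by rewrite !scalerBr !scalerBl !scale1r; apply/rowP => i; rewrite !mxE; ring.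
  rewrite (le_lt_trans (ler_normD _ _))// !normrZ (ger0_norm s0) ger0_norm ?subr_ge0//.
  (* The strict inequality is inherited from [x] when s = 0 and from [y] otherwise. *)
  have [->|s_neq0] := eqVneq s 0; first by rewrite mul0r add0r subr0 mul1r.
  have : s * `|u - y| < s * r by rewrite ltr_pM2l// lt_neqAle eq_sym s_neq0.
  have : (1 - s) * `|u - x| <= (1 - s) * r by rewrite ler_wpM2l ?subr_ge0// ltW.
  by lra.
have dp (s : R) : is_diff s p (fun h => h *: (y - x)).
  have -> : p = (fun s => s *: (y - x)) + cst x by [].
  by apply: is_diff_eq; rewrite addr0.
have dfp (s : R) : s \in `[0, 1] -> is_derive s (1 : R) (f \o p) ('d f (p s) (y - x)).
  move=> s01; have [dps dpsE] := dp s; have dfs := df _ (bp _ s01).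
  have dfps : differentiable (f \o p) s by exact: differentiable_comp.
  apply: DeriveDef; first exact: diff_derivable.
  by rewrite deriveE// diff_comp//= dpsE scale1r.
have sub : {subset `]0, 1[ <= `[0 : R, 1]} by exact: subset_itv_oo_cc.
have cfp : {within `[0, 1], continuous (f \o p)}.
  apply: continuous_in_subspaceT => t; rewrite inE /= => t01.
  apply: differentiable_continuous; apply/derivable1_diffP.
  by have [] := dfp t t01.
have dfp' (s : R) : s \in `]0, 1[ -> is_derive s (1 : R) (f \o p) ('d f (p s) (y - x)).
  by move=> /sub; exact: dfp.
have [z /sub z01] := MVT ltr01 dfp' cfp.
rewrite /p /= scale1r scale0r add0r subrK subr0 mulr1 => E.
by exists (p z) => //; exact: bp.
Qed.

Lemma cvg_jac (m n : nat) (U : set 'rV[R]_m) (f : 'rV[R]_m -> 'rV[R]_n) u :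
  smooth_on U f -> U u -> jac f x @[x --> u] --> jac f u.
Proof.
move=> sf Uu; apply/(cvg_mxP (nbhs_filter u)) => i j; rewrite mxE; under eq_cvg do rewrite mxE.
have : pderiv i f x @[x --> u] --> pderiv i f u.
  by apply: differentiable_continuous; exact: (sf [:: i]).
by move=> /(cvg_mxP (nbhs_filter u)); exact.
Qed.

(** With [L] a right inverse of the derivative at [u], the map v -> f v L - v has small derivative
    near [u], hence is 1/2-Lipschitz on a ball. Thus |y - x| is at most 2 |(f y - f x) L|. *)
Lemma immersion_bilipschitz (m n : nat) (U : set 'rV[R]_m) (f : 'rV[R]_m -> 'rV[R]_n) u :
  open U -> smooth_on U f -> U u -> row_free (jac f u) ->
  exists r c : R, [/\ 0 < r, 0 < c, ball u r `<=` U &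
    forall x y, ball u r x -> ball u r y -> `|y - x| <= c * `|f y - f x|].
Proof.
move=> oU sf Uu fr.
have [L LE] : exists L, jac f u *m L = 1%:M by exists (pinvmx (jac f u)); exact: mulmxVp.
(* Chosen so that [m%:R * e] is at most 1/2; the summand 1 keeps the denominator positive when m =
   0. *)
pose e : R := (2 * (m%:R + 1))^-1.
have e0 : 0 < e by rewrite invr_gt0 mulr_gt0// ltr_wpDl.
have Lf : jac f x *m L @[x --> u] --> (1%:M : 'M[R]_m).
  by rewrite -LE; apply: (cvg_mulmxr (nbhs_filter u)); exact: cvg_jac sf Uu.
have nU : \forall x \near u, U x by exact: open_nbhs_nbhs (conj oU Uu).
have /nbhs_ballP[r /= r0 br] : \forall x \near u, U x /\ `|1%:M - jac f x *m L| <= e.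
  by apply: filterI => //; move/cvgrPdist_le: Lf; exact.
pose c : R := 2 * (n%:R * `|L|) + 1.
exists r, c; split => //.
- by rewrite ltr_wpDl// mulr_ge0// mulr_ge0.
- by move=> x /br[].
move=> x y ux uy.
have key : `|(f y - f x) *m L - (y - x)| <= 2^-1 * `|y - x|.
  apply: mx_norm_le => [|i k]; first by rewrite mulr_ge0.
  rewrite (ord1 i).
  pose h z := (f z *m L) 0 k.
  have dh z : ball u r z -> is_diff z h (fun v => (v *m jac f z *m L) 0 k).
    move=> /br[Uz _]; have dfz := smooth_on_differentiable sf Uz.
    have dfL := differentiable_mulmxr L dfz.
    apply: DiffDef; first by move/differentiable_mxP: dfL; exact.
    apply/funext => v; rewrite -deriveE; last by move/differentiable_mxP: dfL; exact.
    by rewrite -derive_entry// deriveE// diff_jac// jac_mulmxr// mulmxA.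
  have [z uz] := mean_value (fun z uz => @ex_diff _ _ _ _ _ _ _ (dh z uz)) ux uy.
  rewrite (@diff_val _ _ _ _ _ _ _ (dh z uz)) => E.
  have -> : ((f y - f x) *m L - (y - x)) 0 k = - ((y - x) *m (1%:M - jac f z *m L)) 0 k.
    have mxB (A B : 'rV[R]_m) : (A - B) 0 k = A 0 k - B 0 k by rewrite !mxE.
    rewrite mulmxBr mulmx1 mulmxA !mxB mulmxBl mxB -/(h y) -/(h x) E.
    by ring.
  rewrite normrN (le_trans (normr_entry_le _ _ _))// (le_trans (norm_mulmx_le _ _))//.
  rewrite ler_wpM2r//; have [_ bz] := br _ uz.
  rewrite (@le_trans _ _ (m%:R * e))//; first by rewrite ler_wpM2l.
  rewrite /e invfM mulrCA ler_piMr// ler_pdivrMr ?ltr_wpDl// mul1r.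
  by rewrite lerDl.
have : `|y - x| <= `|(f y - f x) *m L| + 2^-1 * `|y - x|.
  rewrite (le_trans _ (lerD (lexx _) key))// -[X in `|X| <= _](subKr ((f y - f x) *m L)).
  exact: ler_normB.
have := norm_mulmx_le (f y - f x) L.
have : 0 <= `|f y - f x| by [].
rewrite /c mulrDl mul1r -[2 * _ * _]mulrA.
set p := `|_ *m L|; set q := _ * `|f y - f x|.
by move: p q => p q; lra.
Qed.

Lemma near0_scale (V : normedModType R) (P : set V) (v : V) :
  (\forall h \near 0, P h) -> \forall s \near (0 : R)^', P (s *: v).
Proof.
move=> nP; have : s *: v @[s --> (0 : R)] --> (0 : V).
  by rewrite -[X in _ --> X](scale0r v); apply: scalel_continuous.
by move=> /(_ _ nP); exact: nbhs_dnbhs.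
Qed.

(** Along a direction [v] killed by the derivative of [f], the increments of [f] are o(s), hence so
    are those of [g]. *)
Lemma jac_kernel_sub (m n p : nat) (f : 'rV[R]_m -> 'rV[R]_n) (g : 'rV[R]_m -> 'rV[R]_p)
    (C : R) (x v : 'rV[R]_m) :
  differentiable f x -> differentiable g x ->
  (\forall h \near (0 : 'rV[R]_m), `|g (h + x) - g x| <= C * `|f (h + x) - f x|) ->
  v *m jac f x = 0 -> v *m jac g x = 0.
Proof.
move=> df dg gf vf.
have [->|v0] := eqVneq v 0; first by rewrite mul0mx.
have nv0 : 0 < `|v| by rewrite normr_gt0.
apply/eqP; rewrite -normr_le0; apply/ler_addgt0Pr => e e0; rewrite add0r.
pose d := e / (`|v| * (`|C| + 1)).
have C0 : 0 < `|C| + 1 by rewrite ltr_wpDl.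
have d0 : 0 < d by rewrite divr_gt0// mulr_gt0.
near (0 : R)^' => s.
have s0 : s != 0 by near: s; exact: nbhs_dnbhs_neq.
have h1 : `|g (s *: v + x) - g x| <= C * `|f (s *: v + x) - f x|.
  by near: s; exact: near0_scale gf.
have h2 : `|f (s *: v + x) - f x| <= d * (`|s| * `|v|).
  rewrite -normrZ -[X in `|X|]subr0 -(_ : 'd f x (s *: v) = 0).
    by near: s; exact: near0_scale (differentiable_near_le df d0).
  by rewrite diff_jac// -scalemxAl vf scaler0.
have h3 : `|g (s *: v + x) - g x - s *: (v *m jac g x)| <= d * (`|s| * `|v|).
  rewrite -normrZ scalemxAl -diff_jac//.
  by near: s; exact: near0_scale (differentiable_near_le dg d0).
have ns : 0 < `|s| by rewrite normr_gt0.
rewrite -(ler_pM2l ns) -normrZ.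
rewrite (@le_trans _ _ (`|g (s *: v + x) - g x| + d * (`|s| * `|v|)))//.
  rewrite (le_trans _ (lerD (lexx _) h3))//.
  rewrite -[X in `|X| <= _](subKr (g (s *: v + x) - g x)).
  exact: ler_normB.
have h4 : C * `|f (s *: v + x) - f x| <= `|C| * (d * (`|s| * `|v|)).
  rewrite (@le_trans _ _ (`|C| * `|f (s *: v + x) - f x|))//.
    by rewrite ler_wpM2r// ler_norm.
  by rewrite ler_wpM2l.
rewrite (le_trans (lerD (le_trans h1 h4) (lexx _)))//.
rewrite [leLHS](_ : _ = `|s| * e)//; rewrite /d; field.
by rewrite !gt_eqF.
Unshelve. all: by end_near. Qed.

Lemma immersion_local_param (m n : nat) (U : set 'rV[R]_m) (f : 'rV[R]_m -> 'rV[R]_n) u :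
  open U -> smooth_on U f -> U u -> row_free (jac f u) ->
  exists V, [/\ open_nbhs u V, V `<=` U & local_param (f @` V) V f].
Proof.
move=> oU sf Uu fr.
have [r [c [r0 c0 bU bl]]] := immersion_bilipschitz oU sf Uu fr.
exists (ball u r); split; [|exact: bU|].
  by split; [exact: ball_open|exact: ballxx].
have inj x y : ball u r x -> ball u r y -> f x = f y -> x = y.
  move=> ux uy fxy; have := bl _ _ uy ux.
  by rewrite fxy subrr normr0 mulr0 normr_le0 subr_eq0 => /eqP.
split.
- exact: ball_open.
- exact: sub_smooth_on sf.
- move=> x ux; rewrite -kermx_eq0 -submx0; apply/rV_subP => v /sub_kermxP vJ.
  have dfx := smooth_on_differentiable sf (bU _ ux).
  rewrite submx0; apply/eqP.
  (* Comparing [f] with the identity turns the Lipschitz bound into injectivity of the derivative at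
     every point of the ball. *)
  have did : differentiable (@id 'rV[R]_m) x by [].
  have := @jac_kernel_sub _ _ _ f id c x v dfx did.
  rewrite -[v *m jac id x]diff_jac// diff_val; apply => //.
  have : \forall y \near x, `|y - x| <= c * `|f y - f x|.
    have : nbhs x (ball u r) by apply: open_nbhs_nbhs; split => //; exact: ball_open.
    by apply: filterS => y; exact: bl.
  by rewrite (near_shift 0)/=; apply: filterS => h; rewrite subr0.
- by move=> x y; rewrite !inE; exact: inj.
- move=> V oV VU; exists (\bigcup_(v in V) \bigcup_(e in [set e | ball v e `<=` V])
      ball (f v) (e / c)).
    by apply: bigcup_open => v Vv; apply: bigcup_open => e _; exact: ball_open.
  apply/seteqP; split=> [_ [v Vv <-]|_ [[w uw <-] [v Vv [e /= be]]]].
    split; first by exists v => //; exact: VU.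
    exists v => //.
    have /nbhs_ballP[e /= e0 be] : nbhs v V by exact: open_nbhs_nbhs.
    by exists e => //; apply: ballxx; rewrite divr_gt0.
  rewrite -ball_normE /ball_ /= => h; exists w => //; apply: be.
  rewrite -ball_normE /ball_ /= distrC.
  rewrite (le_lt_trans (bl _ _ (VU _ Vv) uw))// mulrC -ltr_pdivlMr//.
  by rewrite distrC.
Qed.

End Immersions.

(** * Local parametrizations *)

Section LocalParam.
Variable R : realType.

Lemma jac_eq0 (m n : nat) (f : 'rV[R]_m -> 'rV[R]_n) x : differentiable f x ->
  (forall e, 0 < e -> \forall h \near (0 : 'rV[R]_m), `|f (h + x) - f x| <= e * `|h|) ->
  jac f x = 0.
Proof.
move=> df fe; apply/row_matrixP => i; rewrite row0.
have [->//|v0] := eqVneq (row i (jac f x)) 0.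
pose v : 'rV[R]_m := delta_mx 0 i.
apply/eqP; rewrite -normr_le0; apply/ler_addgt0Pr => e e0; rewrite add0r.
pose d := e / (2 * (`|v| + 1)).
have v1 : 0 < `|v| + 1 by rewrite ltr_wpDl.
have d0 : 0 < d by rewrite divr_gt0// mulr_gt0.
near (0 : R)^' => s.
have s0 : s != 0 by near: s; exact: nbhs_dnbhs_neq.
have h1 : `|f (s *: v + x) - f x| <= d * (`|s| * `|v|).
  by rewrite -normrZ; near: s; exact: near0_scale (fe _ d0).
have h2 : `|f (s *: v + x) - f x - s *: row i (jac f x)| <= d * (`|s| * `|v|).
  rewrite -normrZ rowE scalemxAl -diff_jac//.
  by near: s; exact: near0_scale (differentiable_near_le df d0).
have ns : 0 < `|s| by rewrite normr_gt0.
rewrite -(ler_pM2l ns) -normrZ -[X in `|X|](subKr (f (s *: v + x) - f x)).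
rewrite (le_trans (ler_normB _ _))// (le_trans (lerD h1 h2))//.
rewrite (_ : `|s| * e = d * (`|s| * (`|v| + 1)) + d * (`|s| * (`|v| + 1))).
  by rewrite lerD// ler_pM2l// ler_pM2l// lerDl.
by rewrite /d; field; rewrite gt_eqF.
Unshelve. all: by end_near. Qed.

Lemma near_addr (V : normedModType R) (P : set V) x :
  (\forall y \near x, P y) -> \forall h \near (0 : V), P (h + x).
Proof. by rewrite (near_shift 0)/=; apply: filterS => h; rewrite subr0. Qed.

Lemma differentiable_lipschitz (m n : nat) (f : 'rV[R]_m -> 'rV[R]_n) x :
  differentiable f x -> exists2 K : R, 0 < K &
  \forall h \near (0 : 'rV[R]_m), `|f (h + x) - f x| <= K * `|h|.
Proof.
move=> df; exists (m%:R * `|jac f x| + 1); first by rewrite ltr_wpDl// mulr_ge0.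
apply: filterS (differentiable_near_le df ltr01) => h; rewrite mul1r diff_jac// => H.
rewrite -[X in `|X|](subrK (h *m jac f x)) (le_trans (ler_normD _ _))//.
by rewrite mulrDl mul1r addrC lerD// norm_mulmx_le.
Qed.

Lemma local_param_sub (m n : nat) (M : set 'rV[R]_n) (U : set 'rV[R]_m) phi u :
  local_param M U phi -> U u -> M (phi u).
Proof.
move=> [oU _ _ _ /(_ U oU (@subset_refl _ U))[W _ phiU]] Uu.
by have [] : (M `&` W) (phi u) by rewrite -phiU; exists u.
Qed.

Lemma local_param_smooth (m n : nat) (M : set 'rV[R]_n) (U : set 'rV[R]_m) phi :
  local_param M U phi -> smooth_on U phi.
Proof. by case. Qed.

(** Openness of [psi] onto its image ensures that all points of [M] near [psi u] come from
    parameters near [u], where the immersion estimate applies. *)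
Lemma local_param_inv_lipschitz (m n : nat) (M : set 'rV[R]_n) (U : set 'rV[R]_m) psi u :
  local_param M U psi -> U u -> exists2 C : R, 0 < C &
  \forall y \near psi u, M y ->
    exists u', [/\ U u', psi u' = y & `|u' - u| <= C * `|y - psi u|].
Proof.
move=> [oU spsi rf _ opn] Uu.
have [r [c [r0 c0 bU bl]]] := immersion_bilipschitz oU spsi Uu (rf _ Uu).
exists c => //.
have [W oW bW] := opn _ (ball_open u r) bU.
have Wu : W (psi u).
  suff : (M `&` W) (psi u) by case.
  by rewrite -bW; exists u => //; exact: ballxx.
apply: filterS (open_nbhs_nbhs (conj oW Wu)) => y Wy My.
have [u' uu' <-] : (psi @` ball u r) y by rewrite bW.
by exists u'; split=> //; [exact: bU|apply: bl => //; exact: ballxx].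
Qed.

Lemma smooth_map_lipschitz (m n p : nat) (M : set 'rV[R]_n) (f : 'rV[R]_n -> 'rV[R]_p) x :
  submanifold m M -> smooth_map m M f -> M x -> exists2 K : R, 0 < K &
  \forall y \near x, M y -> `|f y - f x| <= K * `|y - x|.
Proof.
move=> sM sf /sM[U [psi [lp [u Uu <-]]]].
have [C C0 HC] := local_param_inv_lipschitz lp Uu.
have [K K0] := differentiable_lipschitz (smooth_on_differentiable (sf _ _ lp) Uu).
move=> /nbhs_ballP[r /= r0 HK].
exists (K * C); first exact: mulr_gt0.
(* Within this radius the parameter [u'] stays in the ball where [HK] holds. *)
have rC : 0 < r / C by rewrite divr_gt0.
have : \forall y \near psi u, ball (psi u) (r / C) y by exact: nbhsx_ballx.
apply: filterS2 HC => y HC; rewrite -ball_normE /ball_ /= => yr /HC[u' [Uu' yE le]].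
subst y.
have := HK (u' - u); rewrite /= subrK -mulrA => H.
rewrite (le_trans (H _))//; last by rewrite ler_pM2l.
rewrite -ball_normE /ball_ /= sub0r normrN (le_lt_trans le)// mulrC -ltr_pdivlMr//.
by rewrite distrC.
Qed.

Lemma near_comp (m n : nat) (f : 'rV[R]_m -> 'rV[R]_n) x (P : set 'rV[R]_n) :
  differentiable f x -> (\forall y \near f x, P y) -> \forall y \near x, P (f y).
Proof. by move=> /differentiable_continuous cf nP; exact: cf. Qed.

(** The Lipschitz bound for [chi'] along [M1] says that increments of [phi] are dominated by those
    of [chi \o phi]. This carries both the injectivity of the derivative and the openness from [phi]
    over to [chi \o phi]. *)
Lemma diffeomorphism_local_param (m n : nat) (M0 M1 : set 'rV[R]_n) chi
    (U : set 'rV[R]_m) phi :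
  submanifold m M1 -> diffeomorphism m M0 M1 chi -> local_param M0 U phi ->
  local_param M1 U (chi \o phi).
Proof.
move=> sM1 [[funchi injchi surchi] schi [chi' schi' chiK]] lp.
have [oU sphi rf iphi opn] := lp.
have scp := schi _ _ lp.
have phiM u : U u -> M0 (phi u) by exact: (local_param_sub lp).
have chiM u : U u -> M1 (chi (phi u)) by move=> Uu; apply: funchi; exact: phiM.
have K x : M0 x -> chi' (chi x) = x by move=> M0x; apply: chiK; rewrite inE.
split => //.
- move=> u Uu; have [C C0 HC] := smooth_map_lipschitz sM1 schi' (chiM _ Uu).
  have dphi := smooth_on_differentiable sphi Uu.
  have dcp := smooth_on_differentiable scp Uu.
  have nU : \forall v \near u, U v by exact: open_nbhs_nbhs.
  have := near_comp dcp HC => /(filterI nU).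
  rewrite -kermx_eq0 -submx0 => H; apply/rV_subP => v /sub_kermxP vJ.
  rewrite submx0; apply/eqP.
  have : v *m jac phi u = 0.
    apply: (jac_kernel_sub dcp dphi _ vJ (C := C)).
    apply: filterS (near_addr H) => h /= -[Uh].
    by move=> /(_ (chiM _ Uh)); rewrite !K//; exact: phiM.
  by move/eqP; rewrite mulmx_free_eq0 ?rf// => /eqP.
- move=> u v; rewrite !inE => Uu Uv /= /injchi E; apply: iphi; rewrite ?inE//.
  by apply: E; rewrite inE; exact: phiM.
- move=> V oV VU; have [W0 oW0 phiV] := opn _ oV VU.
  (* The largest open set whose points on [M1] all lie in the image of [V]; what has to be shown is
     that it contains this image. *)
  exists ([set y | M1 y -> ((chi \o phi) @` V) y]^°); first exact: open_interior.
  apply/seteqP; split=> [_ [v Vv <-]|y [M1y /interior_subset]]; last exact.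
  have Uv := VU _ Vv; split; first exact: chiM.
  have [C C0 HC] := smooth_map_lipschitz sM1 schi' (chiM _ Uv).
  have [] : (M0 `&` W0) (phi v) by rewrite -phiV; exists v.
  move=> _ W0v; have /nbhs_ballP[r /= r0 br] : nbhs (phi v) W0 by exact: open_nbhs_nbhs.
  have rC : 0 < r / C by rewrite divr_gt0.
  have : \forall y \near chi (phi v), ball (chi (phi v)) (r / C) y by exact: nbhsx_ballx.
  apply: filterS2 HC => y /= HC yr M1y; have := HC M1y.
  have [x M0x xy] := surchi _ M1y; subst y.
  rewrite !K//; last exact: phiM.
  move=> le; have : (M0 `&` W0) x.
    split=> //; apply: br; rewrite -ball_normE /ball_ /= distrC (le_lt_trans le)//.
    by rewrite mulrC -ltr_pdivlMr// distrC; move: yr; rewrite -ball_normE.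
  by rewrite -phiV => -[w Vw <-]; exists w.
Qed.

(** Near [v] one can write g = psi u' with u' - u = O(h). Modulo the row space of [jac psi u], that
    is, after multiplication by its cokernel [K], the increment of [g] is then only the remainder of
    [psi], which is o(h). *)
Lemma local_param_tangent (m n p : nat) (A : set 'rV[R]_n) (U : set 'rV[R]_m) psi u
    (g : 'rV[R]_p -> 'rV[R]_n) v :
  local_param A U psi -> U u -> differentiable g v -> g v = psi u ->
  (\forall w \near v, A (g w)) -> (jac g v <= jac psi u)%MS.
Proof.
move=> lp Uu dg gv nA.
have [C C0 HC] := local_param_inv_lipschitz lp Uu.
have dpsi := smooth_on_differentiable (local_param_smooth lp) Uu.
have [L L0 HL] := differentiable_lipschitz dg.
rewrite submxE; set K := cokermx _.
have JK : jac psi u *m K = 0 by exact: mulmx_coker.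
rewrite -(jac_mulmxr _ dg); apply/eqP; apply: jac_eq0.
  exact: differentiable_mulmxr.
move=> e e0.
(* Makes the product of [d] with the three Lipschitz-type constants equal to [e]. *)
pose d := e / ((n%:R * `|K| + 1) * (C * L)).
have c1 : 0 < n%:R * `|K| + 1 by rewrite ltr_wpDl// mulr_ge0.
have CL : 0 < C * L by rewrite mulr_gt0.
have d0 : 0 < d by rewrite divr_gt0// mulr_gt0.
have /nbhs_ballP[r /= r0 Hr] := differentiable_near_le dpsi d0.
have nC : \forall y \near g v, ball (g v) (r / C) y.
  by apply: nbhsx_ballx; rewrite divr_gt0.
move: HC; rewrite -gv => HC.
near=> h.
have Lh : `|g (h + v) - g v| <= L * `|h| by near: h.
have Ag : A (g (h + v)) by near: h; exact: near_addr nA.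
have gr : ball (g v) (r / C) (g (h + v)) by near: h; exact: near_addr (near_comp dg nC).
have [//|u' [Uu' u'E le]] : A (g (h + v)) -> exists u',
    [/\ U u', psi u' = g (h + v) & `|u' - u| <= C * `|g (h + v) - g v|].
  by near: h; exact: near_addr (near_comp dg HC).
have u'r : ball 0 r (u' - u).
  rewrite -ball_normE /ball_ /= sub0r normrN (le_lt_trans le)// mulrC -ltr_pdivlMr//.
  by move: gr; rewrite -ball_normE /ball_ /= distrC.
have := Hr _ u'r; rewrite /= subrK u'E -gv diff_jac// => H.
rewrite -mulmxBl.
have -> : (g (h + v) - g v) *m K = (g (h + v) - g v - (u' - u) *m jac psi u) *m K.
  by rewrite [RHS]mulmxBl -[(u' - u) *m _ *m _]mulmxA JK mulmx0 subr0.
rewrite (le_trans (norm_mulmx_le _ _))//.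
rewrite (@le_trans _ _ ((n%:R * `|K| + 1) * (d * (C * (L * `|h|)))))//.
  apply: ler_pM => //; first by rewrite lerDl.
  rewrite (le_trans H)// ler_pM2l// (le_trans le)// ler_pM2l//.
rewrite [leLHS](_ : _ = e * `|h|)//; rewrite /d; field.
by rewrite !gt_eqF.
Unshelve. all: by end_near. Qed.

End LocalParam.

(** * The envelope at nonsingular points *)

Section Flow.
Variable R : realType.

Lemma dot_mx (n : nat) (v w : 'rV[R]_n) : dot v w = (v *m w^T) 0 0.
Proof. by rewrite mxE; apply: eq_bigr => i _; rewrite mxE. Qed.

Lemma dotDl (n : nat) (v v' w : 'rV[R]_n) : dot (v + v') w = dot v w + dot v' w.
Proof. by rewrite !dot_mx mulmxDl mxE. Qed.

Lemma dotC (n : nat) (v w : 'rV[R]_n) : dot v w = dot w v.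
Proof. by apply: eq_bigr => i _; rewrite mulrC. Qed.

Lemma dotZr (n : nat) a (v w : 'rV[R]_n) : dot v (a *: w) = a * dot v w.
Proof. by rewrite !dot_mx linearZ -scalemxAr mxE. Qed.

Lemma dot_mulmxr (m n : nat) (v : 'rV[R]_n) (a : 'rV[R]_m) (J : 'M[R]_(m, n)) :
  dot v (a *m J) = \sum_j a 0 j * dot v (row j J).
Proof.
rewrite dot_mx trmx_mul mulmxA mxE; apply: eq_bigr => j _.
rewrite [a^T _ _]mxE mulrC; congr (_ * _).
by rewrite mxE; apply: eq_bigr => k _; rewrite !mxE.
Qed.

Lemma pderiv_dot (m n : nat) (f g : 'rV[R]_m -> 'rV[R]_n) i x :
  differentiable f x -> differentiable g x ->
  pderiv i (fun y => dot (f y) (g y)) x = dot (pderiv i f x) (g x) + dot (f x) (pderiv i g x).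
Proof.
move=> df dg.
have df' k : derivable (fun y => f y 0 k) x (delta_mx 0 i).
  by apply: diff_derivable; move/differentiable_mxP: df; exact.
have dg' k : derivable (fun y => g y 0 k) x (delta_mx 0 i).
  by apply: diff_derivable; move/differentiable_mxP: dg; exact.
rewrite /pderiv.
have -> : (fun y => dot (f y) (g y)) = \sum_k (fun y => f y 0 k * g y 0 k).
  by apply/funext => y; rewrite fct_sumE.
rewrite derive_sum => [|k]; last exact: derivableM.
rewrite /dot -big_split; apply: eq_bigr => k _ /=.
by rewrite deriveM// -!derive_entry// /GRing.scale /= addrC [_ * g x 0 k]mulrC.
Qed.

Lemma cross_prod_orth (n : nat) (A : 'M[R]_(n, n.+1)) i :
  dot (row i A) (cross_prod A) = 0.
Proof.
rewrite cross_prodP (@determinant_alternate _ _ _ (lshift n 0) (rshift 1 i))//.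
by move=> j; rewrite col_mxEu col_mxEd mxE.
Qed.

Section Homogeneous.
Variable n : nat.

(* Homogeneous coordinates of the hyperplane [v . x = c]. *)
Definition homog (v : 'rV[R]_n) (c : R) : 'rV[R]_n.+1 :=
  \row_i (if unlift ord_max i is Some k then v 0 k else - c).

Lemma homogE_lift v c k : homog v c 0 (lift ord_max k) = v 0 k.
Proof. by rewrite mxE liftK. Qed.

Lemma homogE_max v c : homog v c 0 ord_max = - c.
Proof. by rewrite mxE unlift_none. Qed.

Lemma dot_homog v c (w : 'rV[R]_n.+1) :
  dot (homog v c) w = dot v (\row_k w 0 (lift ord_max k)) - c * w 0 ord_max.
Proof.
rewrite /dot (bigD1_ord ord_max)//= homogE_max addrC mulNr; congr (_ - _).
by apply: eq_bigr => k _; rewrite homogE_lift mxE.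
Qed.

Lemma smooth_on_homog (m : nat) (U : set 'rV[R]_m) v c : open U ->
  smooth_on U v -> smooth_on U c -> smooth_on U (fun x => homog (v x) (c x)).
Proof.
move=> oU sv sc; apply/smooth_on_mxP => // i j.
have [k jk|jm] := unliftP ord_max j.
  apply: (@eq_smooth_on _ _ _ _ (fun x => v x 0 k)) => //; last first.
    by move/smooth_on_mxP: sv; exact.
  by move=> x _; rewrite (ord1 i) jk homogE_lift.
apply: (@eq_smooth_on _ _ _ _ (fun x => -1 * c x)) => //; last first.
  by apply: smooth_onM => //; exact: smooth_on_cst.
by move=> x _; rewrite (ord1 i) jm homogE_max mulN1r.
Qed.

Lemma pderiv_homog (m : nat) (v : 'rV[R]_m -> 'rV[R]_n) (c : 'rV[R]_m -> R) x i :
  differentiable v x -> differentiable c x ->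
  pderiv i (fun x => homog (v x) (c x)) x = homog (pderiv i v x) (pderiv i c x).
Proof.
move=> dv dc.
have dvc : differentiable (fun x => homog (v x) (c x)) x.
  apply/differentiable_mxP => a j; rewrite (ord1 a).
  have [k ->|->] := unliftP ord_max j.
    under eq_fun do rewrite homogE_lift.
    by move/differentiable_mxP: dv; exact.
  under eq_fun do rewrite homogE_max.
  exact: differentiableN.
apply/rowP => j; rewrite /pderiv derive_entry//.
have [k ->|->] := unliftP ord_max j.
  by under eq_fun do rewrite homogE_lift; rewrite homogE_lift -derive_entry.
under eq_fun do rewrite homogE_max.
by rewrite homogE_max deriveN//; exact: diff_derivable.
Qed.

End Homogeneous.

End Flow.

(** * The correspondence equations and the parametrized envelope *)

Section Envelope.
Variables (R : realType) (m : nat) (M0 M1 : set 'rV[R]_m.+1).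
Variables (n0 n1 chi : 'rV[R]_m.+1 -> 'rV[R]_m.+1) (theta : 'rV[R]_m.+1 -> R).
Hypothesis hM1 : hypersurface M1.
Hypotheses (hn0 : unit_normal_field M0 n0) (hn1 : unit_normal_field M1 n1).
Hypothesis hchi : diffeomorphism m M0 M1 chi.
Hypothesis htheta : relatively_oriented M0 n0 n1 chi theta.
Variable t : R.
Hypothesis t01 : 0 <= t <= 1.
Variables (U : set 'rV[R]_m) (phi : 'rV[R]_m -> 'rV[R]_m.+1).
Hypothesis lp : local_param M0 U phi.

Local Notation nt := (flow_n n0 n1 chi theta t).
Local Notation ct := (flow_c n0 n1 chi theta t).

Let oU : open U. Proof. by case: lp. Qed.

Let smooth_n0 : smooth_on U (n0 \o phi).
Proof. exact: hn0.1 lp. Qed.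

Let smooth_n1 : smooth_on U (n1 \o chi \o phi).
Proof. exact: hn1.1 (diffeomorphism_local_param hM1 hchi lp). Qed.

Let smooth_chi : smooth_on U (chi \o phi).
Proof. by have [_ /(_ _ _ lp)] := hchi. Qed.

Let smooth_theta : smooth_on U (theta \o phi).
Proof. exact: htheta.1 lp. Qed.

Let theta_pi u : U u -> - pi < theta (phi u) < pi.
Proof. by move=> Uu; have [] := htheta.2 _ (local_param_sub lp Uu). Qed.

Let smooth_lambda s : smooth_on U (fun u => lambda s (theta (phi u))).
Proof. by apply: smooth_on_lambda. Qed.

Lemma smooth_flow_n : smooth_on U (nt \o phi).
Proof. by apply: smooth_onD => //; apply: smooth_onZ. Qed.

Lemma smooth_flow_c : smooth_on U (ct \o phi).
Proof.
apply: smooth_onD => //; apply: smooth_onM => //; first exact: smooth_on_dot.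
by apply: smooth_on_dot => //; exact: local_param_smooth lp.
Qed.

Lemma pderiv_flow_n u : U u -> exists mu : R, forall i,
  pderiv i (nt \o phi) u = mu * pderiv i (theta \o phi) u *: nt (phi u)
    + (lambda t (theta (phi u)) *: pderiv i (n1 \o chi \o phi) u
       + lambda (1 - t) (theta (phi u)) *: pderiv i (n0 \o phi) u
       + sigma t (theta (phi u)) *: (pderiv i (theta \o phi) u *: n0 (phi u))).
Proof.
move=> Uu; have [mu D1 D2] := is_derive_lambda (theta_pi Uu) t01; exists mu => i.
have dth := smooth_on_differentiable smooth_theta Uu.
have Dl s a : is_derive (theta (phi u)) (1 : R) (lambda s) a ->
    pderiv i (fun u => lambda s (theta (phi u))) u = a * pderiv i (theta \o phi) u.
  move=> [da Da]; have dl : differentiable (lambda s) (theta (phi u)).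
    exact/derivable1_diffP.
  rewrite /pderiv deriveE; last exact: (differentiable_comp dth dl).
  rewrite (diff_comp dth dl)/= deriv1E// derive1E Da.
  by rewrite /GRing.scale /= mulrC deriveE.
have dlam s := smooth_on_differentiable (smooth_lambda s) Uu.
have dn0 := smooth_on_differentiable smooth_n0 Uu.
have dn1 := smooth_on_differentiable smooth_n1 Uu.
have Dz (l : 'rV[R]_m -> R) (f : 'rV[R]_m -> 'rV[R]_m.+1) k :
    differentiable l u -> differentiable f u ->
    pderiv i (fun v => l v *: f v) u 0 k =
    l u * pderiv i f u 0 k + f u 0 k * pderiv i l u.
  move=> dl df; have dfk : differentiable (fun v => f v 0 k) u.
    by move/differentiable_mxP: df; exact.
  rewrite /pderiv derive_entry; last first.
    apply/differentiable_mxP => a b; under eq_fun do rewrite mxE.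
    by apply: differentiableM => //; move/differentiable_mxP: df; exact.
  under eq_fun do rewrite mxE.
  by rewrite deriveM ?derive_entry//; exact: diff_derivable.
have dlf s (f : 'rV[R]_m -> 'rV[R]_m.+1) : smooth_on U f ->
    derivable (fun v => lambda s (theta (phi v)) *: f v) u (delta_mx 0 i).
  move=> sf; apply: diff_derivable; apply: (smooth_on_differentiable _ Uu).
  exact: smooth_onZ.
rewrite /pderiv deriveD; [|exact: dlf smooth_n1|exact: dlf smooth_n0].
apply/rowP => k; rewrite mxE [X in X + _ = _]Dz// [X in _ + X = _]Dz//.
rewrite (Dl t _ D1) (Dl (1 - t) _ D2) /flow_n !mxE /pderiv /=.
by ring.
Qed.

Definition flow_mx u : 'M[R]_m.+1 :=
  col_mx (nt (phi u)) (jac (nt \o phi) u) : 'M[R]_(1 + m, m.+1).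

Lemma flow_mxE_u u (j : 'I_1) k : flow_mx u (lshift m j) k = nt (phi u) 0 k.
Proof. by rewrite [LHS]col_mxEu ord1. Qed.

Lemma flow_mxE_d u j k : flow_mx u (rshift 1 j) k = pderiv j (nt \o phi) u 0 k.
Proof. by rewrite [LHS]col_mxEd mxE. Qed.

Lemma frame_mxE_l (f : 'rV[R]_m -> 'rV[R]_m.+1) u k (j : 'I_1) :
  frame_mx f u k (lshift m j) = f u 0 k.
Proof. by rewrite [LHS]row_mxEl mxE ord1. Qed.

Lemma frame_mxE_r (f : 'rV[R]_m -> 'rV[R]_m.+1) u k j :
  frame_mx f u k (rshift 1 j) = pderiv j f u 0 k.
Proof. by rewrite [LHS]row_mxEr !mxE. Qed.

Lemma dtheta_mxE_l u k (j : 'I_1) : dtheta_mx n0 theta phi u k (lshift m j) = 0.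
Proof. by rewrite [LHS]row_mxEl mxE. Qed.

Lemma dtheta_mxE_r u k j :
  dtheta_mx n0 theta phi u k (rshift 1 j) = pderiv j (theta \o phi) u * n0 (phi u) 0 k.
Proof. by rewrite [LHS]row_mxEr mxE. Qed.

Lemma unitmx_flow_mx u : U u ->
  (N'_mx n0 n1 chi theta t phi u \in unitmx) = (flow_mx u \in unitmx).
Proof.
move=> Uu; have [mu Hmu] := pderiv_flow_n Uu.
pose b : 'cV[R]_m := \col_i (mu * pderiv i (theta \o phi) u).
pose B : 'M[R]_(1 + m) := block_mx 1%:M 0 b 1%:M.
pose NT : 'M[R]_(1 + m, m.+1) := (N'_mx n0 n1 chi theta t phi u)^T.
pose J : 'M[R]_(m, m.+1) := \matrix_(i, k)
  (lambda t (theta (phi u)) * pderiv i (n1 \o chi \o phi) u 0 k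
   + lambda (1 - t) (theta (phi u)) * pderiv i (n0 \o phi) u 0 k
   + sigma t (theta (phi u)) * (pderiv i (theta \o phi) u * n0 (phi u) 0 k)).
have E3 (a1 a2 a3 : R) (A1 A2 A3 : 'M[R]_m.+1) i k :
  (a1 *: A1 + a2 *: A2 + a3 *: A3) i k = a1 * A1 i k + a2 * A2 i k + a3 * A3 i k.
  by rewrite !mxE.
(* The theta term has first column 0, so the first row of the transpose is n_t itself. *)
have NTE : NT = col_mx (nt (phi u)) J.
  apply/matrixP => i k; have [j ->|j ->] := @split_ordP 1 m i.
    by rewrite col_mxEu [LHS]mxE /N'_mx E3 !frame_mxE_l dtheta_mxE_l mulr0 addr0 !mxE ord1.
  by rewrite col_mxEd [LHS]mxE /N'_mx E3 !frame_mxE_r dtheta_mxE_r [RHS]mxE.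
have -> : flow_mx u = B *m NT.
  rewrite NTE mul_block_col mul1mx mul0mx addr0 mul1mx.
  apply: (congr1 (fun X => col_mx (nt (phi u)) X : 'M[R]_(1 + m, m.+1))).
  apply/matrixP => i k; rewrite [LHS]mxE Hmu mxE [RHS]mxE; congr (_ + _).
    by rewrite !mxE big_ord1 !mxE.
  by rewrite !mxE.
rewrite unitmx_mul (_ : B \in unitmx) ?[NT \in _]unitmx_tr//.
by rewrite unitmxE det_lblock !det1 mulr1 unitr1.
Qed.

Lemma correspondsP u y : corresponds n0 n1 chi theta t phi u y <->
  flow_mx u *m y^T = col_mx (ct (phi u))%:M (\col_i pderiv i (ct \o phi) u).
Proof.
have -> : flow_mx u *m y^T = col_mx (nt (phi u) *m y^T) (jac (nt \o phi) u *m y^T).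
  exact: (@mul_col_mx _ 1 m _ _ (nt (phi u)) (jac (nt \o phi) u) y^T).
split=> [[h0 hi]|E]; last have [h0 hi] := @eq_col_mx _ 1 m _ _ _ _ _ E.
  have -> : nt (phi u) *m y^T = (ct (phi u))%:M.
    by apply/matrixP => i j; rewrite !ord1 -dot_mx h0 mxE eqxx.
  rewrite (_ : jac (nt \o phi) u *m y^T = \col_i pderiv i (ct \o phi) u)//.
  apply/matrixP => i j; rewrite (ord1 j) [RHS]mxE -hi dot_mx -jacE -row_mul.
  by rewrite [RHS]mxE.
split; first by rewrite dot_mx h0 mxE eqxx.
by move=> i; rewrite dot_mx -jacE -row_mul hi !mxE.
Qed.

Lemma corresponds_unique u : flow_mx u \in unitmx ->
  exists! y, corresponds n0 n1 chi theta t phi u y.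
Proof.
move=> uA; pose b : 'cV[R]_(1 + m) := col_mx (ct (phi u))%:M (\col_i pderiv i (ct \o phi) u).
exists (invmx (flow_mx u) *m b)^T; split; first by apply/correspondsP; rewrite trmxK mulKVmx.
by move=> y /correspondsP E; rewrite /b -E mulKmx// trmxK.
Qed.

Local Notation nht := (flow_tilde n0 n1 chi theta t).
Local Notation ht := (h_tilde n0 n1 chi theta t phi).

Lemma smooth_flow_tilde : smooth_on U (nht \o phi).
Proof. exact: smooth_on_homog smooth_flow_n smooth_flow_c. Qed.

Definition tilde_mx u : 'M[R]_(m.+1, m.+2) :=
  col_mx (nht (phi u)) (jac (nht \o phi) u) : 'M[R]_(1 + m, m.+2).

Lemma tilde_mxE_u u (j : 'I_1) k : tilde_mx u (lshift m j) k = nht (phi u) 0 k.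
Proof. by rewrite [LHS]col_mxEu ord1. Qed.

Lemma tilde_mxE_d u j k : tilde_mx u (rshift 1 j) k = pderiv j (nht \o phi) u 0 k.
Proof. by rewrite [LHS]col_mxEd mxE. Qed.

Lemma h_tildeE u : ht u = cross_prod (tilde_mx u).
Proof. by []. Qed.

Lemma pderiv_tilde u i : U u -> pderiv i (nht \o phi) u =
  homog (pderiv i (nt \o phi) u) (pderiv i (ct \o phi) u).
Proof.
move=> Uu; apply: pderiv_homog; first exact: smooth_on_differentiable smooth_flow_n Uu.
exact: smooth_on_differentiable smooth_flow_c Uu.
Qed.

Lemma smooth_h_tilde : smooth_on U ht.
Proof.
apply/smooth_on_mxP => // i j.
apply: (@eq_smooth_on _ _ _ _ (fun u =>
  \det (col_mx (delta_mx 0 j) (tilde_mx u) : 'M[R]_(1 + m.+1)))) => //.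
  by move=> u _; rewrite h_tildeE mxE.
apply: smooth_on_det => //; apply/smooth_on_mxP => // k l.
have [k' ->|k' ->] := @split_ordP 1 m.+1 k.
  by under eq_fun do rewrite col_mxEu; exact: smooth_on_cst.
under eq_fun do rewrite col_mxEd.
have := smooth_flow_tilde; rewrite (smooth_on_mxP _ oU) => sn.
have [k'' ->|k'' ->] := @split_ordP 1 m k'.
  by under eq_fun do rewrite tilde_mxE_u; exact: sn.
under eq_fun do rewrite tilde_mxE_d.
have := smooth_on_pderiv k'' smooth_flow_tilde.
by rewrite (smooth_on_mxP _ oU); exact.
Qed.

Lemma dot_flow_tilde_h u : dot (nht (phi u)) (ht u) = 0.
Proof.
rewrite h_tildeE -[RHS](cross_prod_orth (tilde_mx u) (lshift m (0 : 'I_1))); congr dot.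
by apply/rowP => j; rewrite [RHS]mxE tilde_mxE_u.
Qed.

Lemma dot_pderiv_flow_tilde_h u i : dot (pderiv i (nht \o phi) u) (ht u) = 0.
Proof.
rewrite h_tildeE -[RHS](cross_prod_orth (tilde_mx u) (rshift 1 i)); congr dot.
by apply/rowP => j; rewrite [RHS]mxE tilde_mxE_d.
Qed.

(** The last coordinate of the cross product is, up to sign, the minor without the column of the -c
    entries, and this minor is the determinant of [flow_mx u]. *)
Lemma h_tilde_neq0 u : U u -> (ht u 0 ord_max != 0) = (flow_mx u \in unitmx).
Proof.
move=> Uu; rewrite h_tildeE mxE (expand_det_row _ (lshift m.+1 0)) (bigD1 ord_max)//= big1 ?addr0.
  rewrite col_mxEu mxE !eqxx mul1r /cofactor mulf_eq0 signr_eq0 /=.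
  rewrite unitmxE unitfE; congr (\det _ != 0).
  apply/matrixP => i k; rewrite [LHS]mxE [LHS]mxE.
  have -> : @lift (1 + m.+1) (lshift m.+1 0) i = rshift 1 (i : 'I_m.+1) by apply: val_inj.
  rewrite col_mxEd; have [j ->|j ->] := @split_ordP 1 m i.
    by rewrite tilde_mxE_u flow_mxE_u homogE_lift.
  by rewrite tilde_mxE_d flow_mxE_d pderiv_tilde// homogE_lift.
by move=> j jm; rewrite col_mxEu mxE (negbTE jm) andbF mul0r.
Qed.

Definition envelope_param u : 'rV[R]_m.+1 :=
  \row_k ((ht u 0 ord_max)^-1 * ht u 0 (lift ord_max k)).

Lemma corresponds_param u : U u -> ht u 0 ord_max != 0 ->
  corresponds n0 n1 chi theta t phi u (envelope_param u).
Proof.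
move=> Uu h0.
have key v c : dot (homog v c) (ht u) = 0 -> dot v (envelope_param u) = c.
  rewrite dot_homog => /eqP; rewrite subr_eq0 => /eqP E.
  rewrite (_ : envelope_param u = (ht u 0 ord_max)^-1 *: \row_k ht u 0 (lift ord_max k)).
    by rewrite dotZr E mulrC mulfK.
  by apply/rowP => k; rewrite !mxE.
split; first by apply: key; exact: dot_flow_tilde_h.
by move=> i; apply: key; rewrite -pderiv_tilde//; exact: dot_pderiv_flow_tilde_h.
Qed.

Lemma envelope_smooth u : U u ->
  flow_mx u \in unitmx -> hessian_mx n0 n1 chi theta t phi u \in unitmx ->
  exists V, [/\ open_nbhs u V, V `<=` U
    & hypersurface [set y | exists2 v, V v & corresponds n0 n1 chi theta t phi v y]].
Proof.
move=> Uu; rewrite -h_tilde_neq0// => h0 Hu.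
have sh k : smooth_on U (fun v => ht v 0 k).
  by have := smooth_h_tilde; rewrite (smooth_on_mxP _ oU); exact.
have /nbhs_ballP[r /= r0 hr] : \forall v \near u, U v /\ ht v 0 ord_max != 0.
  apply: filterI; first exact: open_nbhs_nbhs.
  have hc : ht v 0 ord_max @[v --> u] --> ht u 0 ord_max.
    by apply: differentiable_continuous; exact: smooth_on_differentiable (sh _) Uu.
  by near=> v; near: v; exact: cvgr_neq0 hc h0.
have oB : open (ball u r) by exact: ball_open.
have Bu : ball u r u by exact: ballxx.
(* [Y] is (y, 1), with y the envelope point: the normalized homogeneous coordinates, orthogonal to
   n~ and to its first derivatives. *)
pose Y v := (ht v 0 ord_max)^-1 *: ht v.
have BU : ball u r `<=` U by move=> v /hr[].
have hB v : ball u r v -> ht v 0 ord_max != 0 by move=> /hr[].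
have sV := smooth_onV oB hB (sub_smooth_on BU (sh ord_max)).
have sY : smooth_on (ball u r) Y := smooth_onZ oB sV (sub_smooth_on BU smooth_h_tilde).
have sy : smooth_on (ball u r) envelope_param.
  apply/smooth_on_mxP => // i k.
  apply: (@eq_smooth_on _ _ _ _ (fun v => Y v 0 (lift ord_max k))) => //.
    by move=> v _; rewrite !mxE.
  by move: sY; rewrite (smooth_on_mxP _ oB); exact.
have dY := smooth_on_differentiable sY Bu.
have dy := smooth_on_differentiable sy Bu.
have fr : row_free (jac envelope_param u).
  rewrite -kermx_eq0 -submx0; apply/rV_subP => a /sub_kermxP aJ; rewrite submx0.
  (* The last coordinate of [Y] is constantly 1 near [u], so [Y] has the same derivative kernel as
     [envelope_param]. *)
  have aY : a *m jac Y u = 0.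
    apply/rowP => k; rewrite mxE [RHS]mxE.
    have [l ->|->] := unliftP ord_max k.
      transitivity ((a *m jac envelope_param u) 0 l); last by rewrite aJ mxE.
      rewrite [RHS]mxE.
      apply: eq_bigr => i _; rewrite [jac Y _ _ _]mxE [jac envelope_param _ _ _]mxE.
      rewrite /pderiv !derive_entry//.
      rewrite (_ : (fun v => Y v 0 (lift ord_max l)) = (fun v => envelope_param v 0 l))//.
      by apply/funext => v; rewrite /Y /envelope_param !mxE.
    apply: big1 => i _; rewrite [jac Y _ _ _]mxE /pderiv derive_entry//.
    rewrite (_ : 'D_ _ _ _ = 0) ?mulr0// -(derive_cst (1 : R) u (delta_mx 0 i)).
    apply: near_eq_derive; apply: filterS (open_nbhs_nbhs (conj oB Bu)) => v /hr[_ hv].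
    by rewrite mxE mulVf.
  have Hi i j : dot (pderiv i (nht \o phi) u) (pderiv j Y u) =
      - ((ht u 0 ord_max)^-1 * hessian_mx n0 n1 chi theta t phi u i j).
    have dn : differentiable (pderiv i (nht \o phi)) u.
      exact: (smooth_flow_tilde [:: i]) Uu.
    have /eqP : pderiv j (fun v => dot (pderiv i (nht \o phi) v) (Y v)) u = 0.
      rewrite /pderiv -(derive_cst (0 : R) u (delta_mx 0 j)); congr ('D_ _ _ _).
      by apply/funext => v; rewrite dotZr dot_pderiv_flow_tilde_h mulr0.
    rewrite pderiv_dot// addrC addr_eq0 => /eqP ->.
    by rewrite /Y dotZr [hessian_mx _ _ _ _ _ _ _ _ _]mxE.
  have aH : hessian_mx n0 n1 chi theta t phi u *m a^T = 0.
    apply/matrixP => i j; rewrite (ord1 j) mxE [RHS]mxE.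
    transitivity (\sum_j (- ht u 0 ord_max) *
      (a 0 j * dot (pderiv i (nht \o phi) u) (pderiv j Y u))).
      apply: eq_bigr => k _; rewrite Hi [a^T _ _]mxE mulrN mulNr mulrN opprK mulrCA.
      by rewrite mulVKf// mulrC.
    rewrite -mulr_sumr (_ : \sum_j _ = 0) ?mulr0//.
    transitivity (dot (pderiv i (nht \o phi) u) (a *m jac Y u)).
      by rewrite dot_mulmxr; apply: eq_bigr => k _; rewrite jacE.
    by rewrite aY; apply: big1 => k _; rewrite mxE mulr0.
  have := congr1 (mulmx (invmx (hessian_mx n0 n1 chi theta t phi u))) aH.
  by rewrite mulKmx// mulmx0 => /eqP; rewrite trmx_eq0.
have [V [[oV Vu] VB lpV]] := immersion_local_param oB sy Bu fr.
exists V; split => //; first by move=> v /VB/hr[].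
(* Uniqueness of the corresponding point over each parameter in [V] identifies the envelope with the
   image of the immersion. *)
rewrite (_ : mkset _ = envelope_param @` V).
  by move=> _ [v Vv <-]; exists V, envelope_param; split => //; exists v.
apply/seteqP; split=> [y [v Vv cy]|_ [v Vv <-]]; have [Uv hv] := hr _ (VB _ Vv).
  exists v => //; have := hv; rewrite h_tilde_neq0// => /corresponds_unique[y' [_ yu]].
  by rewrite -(yu _ cy); apply/esym/yu; exact: corresponds_param.
by exists v => //; exact: corresponds_param.
Unshelve. all: by end_near. Qed.

End Envelope.

(** * Limiting tangent spaces *)

Section Limits.
Variable R : realType.

Lemma cvg_dot (n : nat) (v w : nat -> 'rV[R]_n) v0 w0 :
  v i @[i --> \oo] --> v0 -> w i @[i --> \oo] --> w0 ->
  dot (v i) (w i) @[i --> \oo] --> dot v0 w0.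
Proof.
move=> /cvg_mxP vv /cvg_mxP ww; apply: cvg_big => [|k _]; first exact: add_continuous.
by apply: cvgM; [exact: vv|exact: ww].
Qed.

Lemma cvg_row (p q : nat) (A : nat -> 'M[R]_(p, q)) (A0 : 'M[R]_(p, q)) k :
  A i @[i --> \oo] --> A0 -> row k (A i) @[i --> \oo] --> row k A0.
Proof.
move=> /cvg_mxP AA; apply/cvg_mxP => a j; rewrite mxE.
by under eq_cvg do rewrite mxE; exact: AA.
Qed.

(** A right inverse [B] of the limit reduces full row rank to [\det (A i *m B) != 0], and these
    determinants tend to 1. *)
Lemma near_row_free (p q : nat) (A : nat -> 'M[R]_(p, q)) (A0 : 'M[R]_(p, q)) :
  A i @[i --> \oo] --> A0 -> row_free A0 -> \forall i \near \oo, row_free (A i).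
Proof.
move=> AA /row_freeP[B AB].
have : \det (A i *m B) @[i --> \oo] --> (1 : R).
  by rewrite -(@det1 R p) -AB; apply: cvg_det; exact: cvg_mulmxr.
move=> /cvgr_neq0/(_ (oner_neq0 _)); apply: filterS => i di.
apply/row_freeP; exists (B *m invmx (A i *m B)).
by rewrite mulmxA mulmxV// unitmxE unitfE.
Qed.

(** In d = A0^-1 (A0 - A) d + A0^-1 (A d) the first term is at most |d| / 2 once A is close to A0,
    and is absorbed by the left side; no bound on d has to be known beforehand. *)
Lemma cvg_linear_system (n : nat) (A : nat -> 'M[R]_n) (A0 : 'M[R]_n) (d : nat -> 'cV[R]_n) :
  A i @[i --> \oo] --> A0 -> A0 \in unitmx -> A i *m d i @[i --> \oo] --> (0 : 'cV[R]_n) ->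
  d i @[i --> \oo] --> (0 : 'cV[R]_n).
Proof.
move=> AA A0u Ad.
(* Dominates the constants of both terms: two successive products in the first, one in the
   second. *)
pose K : R := n%:R * (n%:R * `|invmx A0|) + n%:R * `|invmx A0| + 1.
have nA0 : 0 <= n%:R * `|invmx A0| by rewrite mulr_ge0.
have K0 : 0 < K by rewrite ltr_wpDl// addr_ge0// mulr_ge0.
apply/cvgrPdist_le => e e0; near=> i; rewrite sub0r normrN.
have h1 : `|A0 - A i| <= (2 * K)^-1.
  near: i; move/cvgrPdist_le: AA; apply; by rewrite invr_gt0 mulr_gt0.
have h2 : `|A i *m d i| <= e / (2 * K).
  near: i; move/cvgrPdist_le: Ad => /(_ (e / (2 * K))).
  rewrite divr_gt0// ?mulr_gt0// => /(_ isT); apply: filterS => i.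
  by rewrite sub0r normrN.
have dE : d i = invmx A0 *m (A0 - A i) *m d i + invmx A0 *m (A i *m d i).
  by rewrite -mulmxA -mulmxDr -mulmxDl subrK mulKmx.
have h3 : `|invmx A0 *m (A i *m d i)| <= K * (e / (2 * K)).
  rewrite (le_trans (norm_mulmx_le _ _))// mulrAC ler_pM//.
  by rewrite /K -addrA addrCA lerDl addr_ge0// mulr_ge0.
have h4 : `|invmx A0 *m (A0 - A i) *m d i| <= 2^-1 * `|d i|.
  rewrite (le_trans (norm_mulmx_le _ _))// mulrAC ler_wpM2r//.
  rewrite (@le_trans _ _ (n%:R * (n%:R * `|A0 - A i| * `|invmx A0|)))//.
    by rewrite ler_wpM2l// norm_mulmx_le.
  rewrite [X in n%:R * X]mulrAC mulrA (@le_trans _ _ (K * (2 * K)^-1))//.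
    by rewrite ler_pM// ?mulr_ge0// /K -addrA lerDl addr_ge0.
  by rewrite invfM mulrCA mulfV ?gt_eqF// mulr1.
have : `|d i| <= 2^-1 * `|d i| + K * (e / (2 * K)).
  by rewrite {1}dE (le_trans (ler_normD _ _))// lerD.
rewrite (_ : K * _ = 2^-1 * e); last by field; rewrite gt_eqF.
by lra.
Unshelve. all: by end_near. Qed.

Lemma row_base_rank (n k : nat) (T : 'M[R]_n) : \rank T = k ->
  exists2 B : 'M[R]_(k, n), row_free B & (B :=: T)%MS.
Proof. by move=> <-; exists (row_base T); [exact: row_base_free|exact: eq_row_base]. Qed.

Lemma cvg_subspace_mx (n k : nat) (V : nat -> 'M[R]_n) T (B : 'M[R]_(k, n)) :
  cvg_subspace V T -> (B <= T)%MS -> exists2 Bs : nat -> 'M[R]_(k, n),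
    forall i, (Bs i <= V i)%MS & Bs i @[i --> \oo] --> B.
Proof.
move=> [_ VT] BT.
have /choice[ws wsP] : forall j : 'I_k, exists ws : nat -> 'rV[R]_n,
    (forall i, (ws i <= V i)%MS) /\ ws i @[i --> \oo] --> row j B.
  move=> j; have [ws ws1 ws2] := VT (row j B) (submx_trans (row_sub _ _) BT).
  by exists ws.
exists (fun i => \matrix_j ws j i) => [i|].
  by apply/row_subP => j; rewrite rowK; exact: (wsP j).1.
apply/cvg_mxP => j l; under eq_cvg do rewrite mxE.
by have /cvg_mxP/(_ 0 l) := (wsP j).2; rewrite mxE.
Qed.

(* By lower semicontinuity of the rank. *)
Lemma cvg_subspace_closed (n : nat) (V : nat -> 'M[R]_n) T (ws : nat -> 'rV[R]_n) (w : 'rV[R]_n) :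
  cvg_subspace V T -> (forall i, (ws i <= V i)%MS) -> ws i @[i --> \oo] --> w ->
  (w <= T)%MS.
Proof.
move=> VT wV ww; apply/negPn/negP => wT.
have [B Bfree BT] := row_base_rank (erefl (\rank T)).
have [Bs BsV BB] : exists2 Bs : nat -> 'M[R]_(\rank T, n),
    forall i, (Bs i <= V i)%MS & Bs i @[i --> \oo] --> B.
  by apply: cvg_subspace_mx VT _; rewrite BT.
have Xfree : row_free (col_mx B w).
  rewrite /row_free eqn_leq rank_leq_row -addsmxE addn1 -{1}BT.
  rewrite ltn_neqAle mxrankS ?addsmxSl// andbT.
  rewrite (mxrank_leqif_sup (addsmxSl B w)) addsmx_sub submx_refl/=.
  by rewrite BT.
have XX : col_mx (Bs i) (ws i) @[i --> \oo] --> col_mx B w.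
  apply/cvg_mxP => j l; case: (split_ordP j) => j' ->.
    by under eq_cvg do rewrite col_mxEu; rewrite col_mxEu; move/cvg_mxP: BB; exact.
  by under eq_cvg do rewrite col_mxEd; rewrite col_mxEd; move/cvg_mxP: ww; exact.
have [i /eqP ri] := filter_ex (near_row_free XX Xfree).
have : (\rank (col_mx (Bs i) (ws i)) <= \rank (V i))%N.
  by apply: mxrankS; rewrite col_mx_sub BsV wV.
by rewrite ri VT.1 addn1 ltnn.
Qed.

Lemma closure_seq (n : nat) (A : set 'rV[R]_n) p : closure A p ->
  exists2 s : nat -> 'rV[R]_n, forall i, A (s i) & s i @[i --> \oo] --> p.
Proof.
move=> cA.
have /choice[s sP] : forall i, exists x, A x /\ ball p i.+1%:R^-1 x.
  move=> i; have i0 : 0 < i.+1%:R^-1 :> R by rewrite invr_gt0.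
  by have [x [Ax px]] := cA _ (nbhsx_ballx p _ i0); exists x.
exists s => [i|]; first exact: (sP i).1.
apply/cvgrPdist_lt => e e0; near=> i.
have := (sP i).2; rewrite -ball_normE /ball_ /= => /lt_trans; apply.
by near: i; exact: near_infty_natSinv_lt (PosNum e0).
Unshelve. all: by end_near. Qed.

Lemma smooth_point_tangent (m n : nat) (A : set 'rV[R]_n) p :
  smooth_point m A p -> exists T, is_tangent_space m A p T.
Proof.
move=> [U [psi [lp [u Uu up]]]]; exists <<jac psi u>>%MS, U, psi, u; split => //.
exact/eqmxP/genmxE.
Qed.

Lemma tangent_rank (m n : nat) (A : set 'rV[R]_n) p T :
  is_tangent_space m A p T -> \rank T = m.
Proof.
move=> [U [psi [u [[_ _ rf _ _] Uu _ /eqmxP TJ]]]].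
by rewrite TJ; apply/eqP; exact: rf.
Qed.

(** The closure clause supplies at least one sequence of smooth points, so that [T] really is a
    limit and the condition on sequences is not vacuous. *)
Lemma limiting_seq (m n : nat) (A : set 'rV[R]_n) z T :
  is_limiting_tangent_space m A z T -> exists zs Vs,
    [/\ forall i, is_tangent_space m A (zs i) (Vs i), zs i @[i --> \oo] --> z
      & cvg_subspace Vs T].
Proof.
move=> [cz limT]; have [zs zsA zsz] := closure_seq cz.
have /choice[Vs VsP] : forall i, exists V, is_tangent_space m A (zs i) V.
  by move=> i; exact: smooth_point_tangent (zsA i).
by exists zs, Vs; split => //; exact: limT.
Qed.

Lemma limiting_rank (m n : nat) (A : set 'rV[R]_n) z T :
  is_limiting_tangent_space m A z T -> \rank T = m.
Proof.
move=> /limiting_seq[zs [Vs [Vt _ VT]]].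
by rewrite -(VT.1 0%N) (tangent_rank (Vt 0%N)).
Qed.

(** Tangent spaces along a single sequence converge to both [T] and [T']; a vector of [T] is a limit
    of tangent vectors, and such limits lie in [T']. *)
Lemma limiting_sub (m n : nat) (A : set 'rV[R]_n) z T T' :
  is_limiting_tangent_space m A z T -> is_limiting_tangent_space m A z T' ->
  (T <= T')%MS.
Proof.
move=> hT [_ limT']; have [zs [Vs [Vt zz VT]]] := limiting_seq hT.
apply/rV_subP => w /VT.2[ws wV ww].
exact: cvg_subspace_closed (limT' _ _ Vt zz) wV ww.
Qed.

End Limits.

(** * Envelope points as solutions of linear systems, and their limits *)

Section EnvelopePoints.
Variables (R : realType) (m : nat).
Local Notation N := (m.+1 + 2)%N.
Implicit Types (z w : 'rV[R]_N) (T : 'M[R]_N).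

Definition normal_mx : 'M[R]_(N, m.+1) := lsubmx 1%:M.
Definition const_mx1 : 'M[R]_(N, 1) := rsubmx 1%:M *m delta_mx 0 0.

Lemma normal_partE w : normal_part w = w *m normal_mx.
Proof. by rewrite /normal_part /normal_mx mulmx_lsub mulmx1. Qed.

Lemma const_partE w : const_part w = (w *m const_mx1) 0 0.
Proof. by rewrite /const_mx1 mulmxA mulmx_rsub mulmx1 -colE mxE. Qed.

(** The column on the right represents the linear form sending [w] to n . y - c, so the envelope
    equations say that it annihilates [z] and [T]. *)
Lemma envelope_system z w y :
  dot (normal_part w) y = const_part w <-> w *m (normal_mx *m y^T - const_mx1) = 0.
Proof.
rewrite mulmxBr mulmxA dot_mx normal_partE const_partE.
split=> [H|/eqP]; last by rewrite subr_eq0 => /eqP ->.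
by apply/matrixP => i j; rewrite !ord1 mxE [X in _ + X]mxE H subrr mxE.
Qed.

Lemma envelope_pointP z T y : envelope_point z T y <->
  z *m (normal_mx *m y^T - const_mx1) = 0 /\ T *m (normal_mx *m y^T - const_mx1) = 0.
Proof.
split=> [[hz hT]|[hz hT]].
  split; first exact/(envelope_system z).
  apply/row_matrixP => i; rewrite row_mul row0; apply/(envelope_system z).
  by apply: hT; exact: row_sub.
split; first exact/(envelope_system z).
by move=> w /submxP[D ->]; apply/(envelope_system z); rewrite -mulmxA hT mulmx0.
Qed.

Lemma envelope_point_sub z T T' y : (T <= T')%MS ->
  envelope_point z T' y -> envelope_point z T y.
Proof. by move=> TT' [hz hT]; split=> // w wT; apply: hT; exact: submx_trans TT'. Qed.

(** The coefficient matrix of the envelope equations when the rows of [B] form a basis of the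
    tangent space. *)
Definition contact_mx (z : 'rV[R]_N) (B : 'M[R]_(m, N)) : 'M[R]_m.+1 :=
  (col_mx z B : 'M[R]_(1 + m, N)) *m normal_mx.

Lemma contact_mx_sub z (B : 'M[R]_(m, N)) (y : 'rV[R]_m.+1) :
  contact_mx z B *m y^T - (col_mx z B : 'M[R]_(1 + m, N)) *m const_mx1 =
  col_mx (z *m (normal_mx *m y^T - const_mx1)) (B *m (normal_mx *m y^T - const_mx1)).
Proof.
rewrite /contact_mx -mulmxA -mulmxBr.
exact: (@mul_col_mx _ 1 m _ _ z B).
Qed.

Lemma contact_mxE z T (B : 'M[R]_(m, N)) y : (B <= T)%MS -> envelope_point z T y ->
  contact_mx z B *m y^T = (col_mx z B : 'M[R]_(1 + m, N)) *m const_mx1.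
Proof.
move=> /submxP[D ->] /envelope_pointP[hz hT].
apply/eqP; rewrite -subr_eq0 contact_mx_sub hz -mulmxA hT mulmx0; apply/eqP.
exact: (@col_mx0 _ 1 m 1).
Qed.

Lemma contact_mx_envelope z T (B : 'M[R]_(m, N)) y : (T <= B)%MS ->
  contact_mx z B *m y^T = (col_mx z B : 'M[R]_(1 + m, N)) *m const_mx1 ->
  envelope_point z T y.
Proof.
move=> /submxP[D ->] /eqP; rewrite -subr_eq0 contact_mx_sub => /eqP E.
have [hz hB] := @eq_col_mx _ 1 m _ _ _ _ _ (etrans E (esym (@col_mx0 _ 1 m 1))).
by apply/envelope_pointP; rewrite hz -mulmxA hB mulmx0.
Qed.

(** Obtained by differentiating n . n = 1 along a parametrization. *)
Lemma hyperplane_tangent (C : set 'rV[R]_N) p T w : C `<=` @hyperplane_space R m ->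
  is_tangent_space m C p T -> (w <= T)%MS -> dot (normal_part p) (normal_part w) = 0.
Proof.
move=> CZ [U [psi [u [lp Uu <- /eqmxP TJ]]]]; rewrite TJ => /submxP[a ->].
have dpsi := smooth_on_differentiable (local_param_smooth lp) Uu.
have [oU _ _ _ _] := lp.
pose g v := psi v *m normal_mx.
have dg : differentiable g u by exact: differentiable_mulmxr.
rewrite !normal_partE -mulmxA -jac_mulmxr// -/g dot_mulmxr; apply: big1 => i _.
rewrite jacE; have : pderiv i (fun v => dot (g v) (g v)) u = 0.
  rewrite -(derive_cst (1 : R) u (delta_mx 0 i)); apply: near_eq_derive.
  apply: filterS (open_nbhs_nbhs (conj oU Uu)) => v Uv.
  have [n [c [n1 E]]] := CZ _ (local_param_sub lp Uv).
  by rewrite /g -normal_partE E /normal_part /hpoint row_mxKl.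
rewrite pderiv_dot// [X in X + _]dotC -mulr2n => /eqP.
by rewrite mulrn_eq0/= => /eqP ->; rewrite mulr0.
Qed.

(** A relation between the rows reads a n(z) + n(w) = 0 with [w] in [T]. Pairing with n(z) gives a =
    0, nonverticality gives w = 0, and freeness of [B] kills the remaining coefficients. *)
Lemma row_free_contact_mx z T (B : 'M[R]_(m, N)) :
  dot (normal_part z) (normal_part z) = 1 ->
  (forall w, (w <= T)%MS -> dot (normal_part z) (normal_part w) = 0) ->
  nonvertical T -> row_free B -> (B <= T)%MS -> contact_mx z B \in unitmx.
Proof.
move=> nz nT vT Bfree BT; rewrite -row_free_unit -kermx_eq0 -submx0.
apply/rV_subP => a /sub_kermxP aX; rewrite submx0; apply/eqP.
pose a' : 'M[R]_(1, 1 + m) := a.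
have aE : a = row_mx (lsubmx a') (rsubmx a') by rewrite hsubmxK.
pose w := rsubmx a' *m B.
have wT : (w <= T)%MS by exact: submx_trans (submxMl _ _) BT.
have E : lsubmx a' 0 0 *: normal_part z + normal_part w = 0.
  have aM : a *m (col_mx z B : 'M[R]_(1 + m, N)) = lsubmx a' *m z + w.
    by rewrite [X in X *m _]aE; exact: (@mul_row_col _ 1 1 m).
  rewrite -aX /contact_mx mulmxA aM mulmxDl -!normal_partE; congr (_ + _).
  by rewrite {2}(mx11_scalar (lsubmx a')) mul_scalar_mx !normal_partE scalemxAl.
have a0 : lsubmx a' 0 0 = 0.
  have := congr1 (dot (normal_part z)) E.
  rewrite dotC dotDl [X in _ + X]dotC nT// addr0 dotC dotZr nz mulr1 => ->.
  by rewrite dot_mx trmx0 mulmx0 mxE.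
have w0 : w = 0 by apply: vT => //; move: E; rewrite a0 scale0r add0r.
have r0 : rsubmx a' = 0 by apply/eqP; rewrite -(mulmx_free_eq0 _ Bfree) -/w w0.
rewrite aE r0 (mx11_scalar (lsubmx a')) a0 raddf0.
exact: (@row_mx0 _ 1 1 m).
Qed.

Section LimitPoint.
Variables (C : set 'rV[R]_N) (z : 'rV[R]_N) (T : 'M[R]_N).
Hypothesis CZ : C `<=` @hyperplane_space R m.
Hypothesis nz : dot (normal_part z) (normal_part z) = 1.
Hypothesis limT : is_limiting_tangent_space m C z T.
Hypothesis vT : nonvertical T.

Lemma limiting_orth w : (w <= T)%MS -> dot (normal_part z) (normal_part w) = 0.
Proof.
have [zs [Vs [Vt zz [_ VT]]]] := limiting_seq limT.
move=> /VT[ws wV ww].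
have h : dot (normal_part (zs i)) (normal_part (ws i)) @[i --> \oo] -->
    dot (normal_part z) (normal_part w).
  rewrite !normal_partE; under eq_cvg do rewrite !normal_partE.
  by apply: cvg_dot; exact: cvg_mulmxr.
have E : (fun i => dot (normal_part (zs i)) (normal_part (ws i))) = fun=> 0.
  by apply/funext => i; apply: (hyperplane_tangent CZ (Vt i)) (wV i).
rewrite E in h; exact: cvg_unique h (cvg_cst 0).
Qed.

Let contact : exists2 B : 'M[R]_(m, N), (B :=: T)%MS & contact_mx z B \in unitmx.
Proof.
have [B Bfree BT] := row_base_rank (limiting_rank limT); exists B => //.
by apply: (row_free_contact_mx nz limiting_orth vT Bfree); rewrite BT.
Qed.

Lemma envelope_point_ex : exists y, envelope_point z T y.
Proof.
have [B BT Bu] := contact.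
exists (invmx (contact_mx z B) *m ((col_mx z B : 'M[R]_(1 + m, N)) *m const_mx1))^T.
apply: (@contact_mx_envelope _ _ B); first by rewrite BT.
by rewrite trmxK mulKVmx.
Qed.

Lemma envelope_point_cvg zs Vs ys y :
  envelope_point z T y ->
  (forall i, is_tangent_space m C (zs i) (Vs i)) ->
  (forall i, envelope_point (zs i) (Vs i) (ys i)) ->
  zs i @[i --> \oo] --> z -> ys i @[i --> \oo] --> y.
Proof.
move=> Ey Vt Ey' zz; have VT := limT.2 _ _ Vt zz.
have [B BT Bu] := contact.
have BT' : (B <= T)%MS by rewrite BT.
have [Bs BsV BB] := cvg_subspace_mx VT BT'.
pose X i : 'M[R]_(1 + m, N) := col_mx (zs i) (Bs i).
have XX : X i @[i --> \oo] --> (col_mx z B : 'M[R]_(1 + m, N)).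
  apply/cvg_mxP => j l; case: (split_ordP j) => j' ->.
    by under eq_cvg do rewrite col_mxEu; rewrite col_mxEu; move/cvg_mxP: zz; exact.
  by under eq_cvg do rewrite col_mxEd; rewrite col_mxEd; move/cvg_mxP: BB; exact.
have AA : contact_mx (zs i) (Bs i) @[i --> \oo] --> contact_mx z B.
  exact: (@cvg_mulmxr R nat \oo _ (1 + m)%N N m.+1 X).
(* Since [ys i] solves the system at stage i, the difference satisfies a system whose right side
   measures how far [y] is from solving it. This defect tends to 0 because [y] solves the limit
   system. *)
have : (ys i)^T - y^T @[i --> \oo] --> (0 : 'cV[R]_m.+1).
  apply: (cvg_linear_system AA Bu).
  have -> : (fun i => contact_mx (zs i) (Bs i) *m ((ys i)^T - y^T)) =
      (fun i => X i *m (const_mx1 - normal_mx *m y^T)).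
    apply/funext => i; rewrite mulmxBr (contact_mxE (BsV i) (Ey' i)).
    by rewrite [RHS]mulmxBr; congr (_ - _); rewrite /contact_mx -mulmxA.
  have -> : (0 : 'cV[R]_m.+1) =
      (col_mx z B : 'M[R]_(1 + m, N)) *m (const_mx1 - normal_mx *m y^T).
    by rewrite mulmxBr -(contact_mxE BT' Ey) /contact_mx -[_ *m normal_mx *m _]mulmxA subrr.
  exact: (@cvg_mulmxr R nat \oo _ (1 + m)%N N 1%N X).
move=> /cvg_mxP d0; apply/cvg_mxP => a j; rewrite (ord1 a); apply/subr_cvg0.
have := d0 j 0; rewrite mxE; apply: cvg_trans; apply: near_eq_cvg.
by near=> i; rewrite !mxE.
Unshelve. all: by end_near. Qed.

Lemma envelope_point_unique y y' : envelope_point z T y -> envelope_point z T y' -> y = y'.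
Proof.
have [B BT Bu] := contact; have BT' : (B <= T)%MS by rewrite BT.
move=> /(contact_mxE BT') E /(contact_mxE BT') E'.
by apply: trmx_inj; rewrite -(mulKmx Bu y^T) E -E' mulKmx.
Qed.

End LimitPoint.

End EnvelopePoints.

(** * From envelope points of a component back to the flow *)

Section CorrespondingPoint.
Variables (R : realType) (m : nat) (M0 M1 : set 'rV[R]_m.+1).
Variables (n0 n1 chi : 'rV[R]_m.+1 -> 'rV[R]_m.+1) (theta : 'rV[R]_m.+1 -> R).
Hypothesis hM1 : hypersurface M1.
Hypotheses (hn0 : unit_normal_field M0 n0) (hn1 : unit_normal_field M1 n1).
Hypothesis hchi : diffeomorphism m M0 M1 chi.
Hypothesis htheta : relatively_oriented M0 n0 n1 chi theta.
Variable t : R.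
Variables (U : set 'rV[R]_m) (phi : 'rV[R]_m -> 'rV[R]_m.+1).
Hypothesis lp : local_param M0 U phi.

Let oU : open U. Proof. by case: lp. Qed.

Local Notation flow := (geodesic_flow n0 n1 chi theta t \o phi).

Lemma smooth_geodesic_flow : smooth_on U flow.
Proof.
apply/smooth_on_mxP => // a j.
have sn := smooth_flow_n hM1 hn0 hn1 hchi htheta t lp.
have sc := smooth_flow_c hM1 hn0 hn1 hchi htheta t lp.
case: (split_ordP j) => k ->.
  under eq_fun do rewrite /geodesic_flow /= /geodesic_flow /hpoint row_mxEl.
  by move/smooth_on_mxP: sn; exact.
by apply: (eq_smooth_on oU _ sc) => u _; rewrite /= /geodesic_flow /hpoint row_mxEr !mxE mulr1.
Qed.

(** The partial derivatives of the flow are vectors of [T], so the correspondence equations are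
    instances of the envelope equations. *)
Lemma corresponds_envelope u y z T : U u -> flow u = z ->
  envelope_point z T y -> (jac flow u <= T)%MS ->
  corresponds n0 n1 chi theta t phi u y.
Proof.
move=> Uu <- [hz hT] JT.
have dg := smooth_on_differentiable smooth_geodesic_flow Uu.
split; first by move: hz; rewrite /normal_part /const_part /= /geodesic_flow /hpoint
  row_mxKl row_mxKr !mxE mulr1.
move=> i; have := hT _ (submx_trans (row_sub i _) JT).
rewrite normal_partE const_partE -!row_mul -!jac_mulmxr// jacE mxE.
rewrite [X in dot X y](_ : _ = pderiv i (flow_n n0 n1 chi theta t \o phi) u); last first.
  congr (pderiv i _ u); apply/funext => v /=.
  by rewrite -normal_partE /geodesic_flow /hpoint /normal_part row_mxKl.
move=> ->; rewrite mxE /pderiv derive_entry; last exact: differentiable_mulmxr.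
congr ('D__ _ _); apply/funext => v /=.
by rewrite -const_partE /const_part /geodesic_flow /hpoint row_mxKr !mxE mulr1.
Qed.

(** At parameters tending to [u] where the flow meets smooth points of [C], its derivative is
    tangent to [C]; this passes to the limit by continuity of [jac]. *)
Lemma jac_flow_limiting (C : set 'rV[R]_(m.+1 + 2)) u z T : U u -> flow u = z ->
  is_limiting_tangent_space m C z T ->
  (\forall v \near u, C (flow v)) ->
  closure [set v | smooth_point m C (flow v)] u ->
  (jac flow u <= T)%MS.
Proof.
move=> Uu gu limT nC clu.
have nU : \forall v \near u, U v by exact: open_nbhs_nbhs.
(* Tangency at a nearby parameter v requires the flow to stay in [C] around v, not merely at v. *)
have nCC : \forall v \near u, \forall w \near v, C (flow w) by exact: nbhs_interior.
have clW : closure [set v | [/\ smooth_point m C (flow v), U v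
    & \forall w \near v, C (flow w)]] u.
  move=> B nB; have [v /= [sv [[Bv Uv] Cv]]] := clu _ (filterI (filterI nB nU) nCC).
  by exists v.
have [vs vsP vsu] := closure_seq clW.
have /choice[Vs VsP] : forall i, exists V, is_tangent_space m C (flow (vs i)) V.
  by move=> i; have [/smooth_point_tangent] := vsP i.
have cg : flow (vs i) @[i --> \oo] --> z.
  rewrite -gu; apply: (@cvg_comp _ _ _ vs flow \oo (nbhs u) _ vsu).
  by apply: differentiable_continuous; exact: smooth_on_differentiable smooth_geodesic_flow Uu.
have VT := limT.2 _ _ VsP cg.
apply/row_subP => k; apply: (cvg_subspace_closed VT (ws := fun i => row k (jac flow (vs i)))).
  move=> i; apply: submx_trans (row_sub _ _) _.
  have [_ Uv Cv] := vsP i; have [U' [psi [u' [lp' Uu' psiu /eqmxP ->]]]] := VsP i.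
  apply: (local_param_tangent lp' Uu' _ _ Cv); last by [].
  exact: smooth_on_differentiable smooth_geodesic_flow Uv.
apply: cvg_row; apply: (@cvg_comp _ _ _ vs (jac flow) \oo (nbhs u) _ vsu).
exact: cvg_jac smooth_geodesic_flow Uu.
Qed.

End CorrespondingPoint.

Theorem theorem9p3 (R : realType) (m : nat) (M0 M1 : set 'rV[R]_m.+1)
    (n0 n1 chi : 'rV[R]_m.+1 -> 'rV[R]_m.+1) (theta : 'rV[R]_m.+1 -> R)
    (hM0 : hypersurface M0) (hM1 : hypersurface M1)
    (gM0 : generic_hypersurface M0) (gM1 : generic_hypersurface M1)
    (hn0 : unit_normal_field M0 n0) (hn1 : unit_normal_field M1 n1)
    (hchi : diffeomorphism m M0 M1 chi)
    (htheta : relatively_oriented M0 n0 n1 chi theta)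
    (hsing : forall t : R, 0 <= t <= 1 ->
       only_generic_legendrian_singularities m.+1 (@hyperplane_space R m)
         (geodesic_flow n0 n1 chi theta t @` M0)) :
  forall t : R, 0 <= t <= 1 ->
  let Mt := geodesic_flow n0 n1 chi theta t @` M0 in
  [/\ forall U phi u, local_param M0 U phi -> U u ->
        N'_mx n0 n1 chi theta t phi u \in unitmx ->
        exists! y, corresponds n0 n1 chi theta t phi u y,
      forall U phi u, local_param M0 U phi -> U u ->
        smooth_point m Mt (geodesic_flow n0 n1 chi theta t (phi u)) ->
        N'_mx n0 n1 chi theta t phi u \in unitmx ->
        hessian_mx n0 n1 chi theta t phi u \in unitmx ->
        exists V, [/\ open_nbhs u V, V `<=` U
          & hypersurface
              [set y | exists2 v, V v & corresponds n0 n1 chi theta t phi v y]]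
    & forall z, Mt z -> ~ smooth_point m Mt z ->
      forall r (C : 'I_r -> set 'rV[R]_(m.+1 + 2)),
        legendrian_components m.+1 (@hyperplane_space R m) Mt z C ->
      forall j,
        (forall T, is_limiting_tangent_space m (C j) z T -> nonvertical T) ->
      exists y,
        [/\ component_envelope_point (C j) z y,
            forall y', component_envelope_point (C j) z y' -> y' = y,
            forall zs Vs ys,
              (forall i, is_tangent_space m (C j) (zs i) (Vs i)) ->
              (forall i, envelope_point (zs i) (Vs i) (ys i)) ->
              zs i @[i --> \oo] --> z -> ys i @[i --> \oo] --> y
          & forall U phi u, local_param M0 U phi -> U u ->
              geodesic_flow n0 n1 chi theta t (phi u) = z ->
              (\forall v \near u, C j (geodesic_flow n0 n1 chi theta t (phi v))) ->
              closure [set v | smooth_point m (C j)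
                         (geodesic_flow n0 n1 chi theta t (phi v))] u ->
              corresponds n0 n1 chi theta t phi u y]].
Proof.
move=> t t01 Mt; split=> [U phi u lp Uu|U phi u lp Uu _|z Mtz _ r C].
- by rewrite (unitmx_flow_mx hM1 hn0 hn1 hchi htheta t01 lp Uu); exact: corresponds_unique.
- rewrite (unitmx_flow_mx hM1 hn0 hn1 hchi htheta t01 lp Uu).
  exact: (envelope_smooth hM1 hn0 hn1 hchi htheta lp Uu).
move=> [gz CZ _ _ lim] j vert; have [T limT] := lim j.
have vT := vert _ limT.
(* The germ equality at [z] itself places [z] on some component, possibly other than [C j]; this
   suffices for its normal to be a unit vector. *)
have [k _ Ckz] : (\bigcup_j C j) z by have [h _] := nbhs_singleton gz; exact: h.
have nz : dot (normal_part z) (normal_part z) = 1.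
  by have [v [c [v1 ->]]] := CZ _ _ Ckz; rewrite /normal_part /hpoint row_mxKl.
have [y Ey] := envelope_point_ex (CZ j) nz limT vT.
exists y; split.
- by exists T.
(* A second limiting tangent space contains [T], so its envelope points also solve the system of
   [T], which has only one solution. *)
- move=> y' [T' limT' /(envelope_point_sub (limiting_sub limT limT')) Ey'].
  exact: (envelope_point_unique (CZ j) nz limT vT).
- by move=> zs Vs ys; apply: (envelope_point_cvg (CZ j) nz limT vT).
- move=> U phi u lp Uu gz' nC clu.
  apply: (corresponds_envelope hM1 hn0 hn1 hchi htheta lp Uu gz' Ey).
  exact: (jac_flow_limiting hM1 hn0 hn1 hchi htheta lp Uu gz' limT nC clu).
Qed.
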